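(* Let $n\geqslant 2$. There exists a constant $C_n>0$ depending only on $n$ such that the following holds. Let $D\subset\mathbb{R}^n$ be a domain and let $Q:\mathbb{R}^n\to[0,\infty]$ be a Lebesgue measurable function with $Q\in L^1(\mathbb{R}^n)$. Let $\mathfrak{F}_Q(D)$ be the family of all open discrete mappings $f:D\to\mathbb{R}^n$ that satisfy the inverse Poletsky inequality with the function $Q$ at every point $y_0\in f(D)$. Then for every $x_0\in D$ and every $r_0$ with $0<2r_0<\operatorname{dist}(x_0,\partial D)$, $$|f(x)-f(x_0)|\leqslant\frac{C_n\cdot(\|Q\|_1)^{1/n}}{\log^{1/n}\left(1+\frac{r_0}{|x-x_0|}\right)}\qquad\text{for all } x\in B(x_0,r_0)\text{ and all } f\in\mathfrak{F}_Q(D),$$ where $\|Q\|_1$ is the norm of $Q$ in $L^1(\mathbb{R}^n)$ (for $x=x_0$ the right-hand side is understood as $0$). In particular, the family $\mathfrak{F}_Q(D)$ is equicontinuous in $D$ with respect to the Euclidean metric: for every $x_0\in D$ and $\varepsilon>0$ there is $\delta=\delta(\varepsilon,x_0)>0$ such that $x\in D$, $|x-x_0|<\delta$ implies $|f(x)-f(x_0)|<\varepsilon$ for all $f\in\mathfrak{F}_Q(D)$.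
   Context: Mappings are continuous; a domain is a nonempty open connected set. A mapping $f:D\to\mathbb{R}^n$ is open if it maps open subsets of $D$ to open sets, and discrete if $f^{-1}(y)$ consists of isolated points for every $y\in\mathbb{R}^n$. $B(x_0,r)=\{x\in\mathbb{R}^n:|x-x_0|<r\}$, $S(x_0,r)=\{x\in\mathbb{R}^n:|x-x_0|=r\}$, $\overline{\mathbb{R}^n}=\mathbb{R}^n\cup\{\infty\}$, and $m$ is Lebesgue measure. In this statement $\operatorname{dist}$ is Euclidean distance (equal to $+\infty$ if $D=\mathbb{R}^n$). Modulus: for a family $\Gamma$ of curves, $M(\Gamma)=\inf\int_{\mathbb{R}^n}\rho^n(x)\,dm(x)$, the infimum being over all Borel functions $\rho:\mathbb{R}^n\to[0,\infty]$ with $\int_\gamma\rho\,|dx|\geqslant1$ for every locally rectifiable $\gamma\in\Gamma$. For $y_0\in\mathbb{R}^n$ and $0<r_1<r_2<\infty$ put $A(y_0,r_1,r_2)=\{y\in\mathbb{R}^n:r_1<|y-y_0|<r_2\}$. For $E,F\subset\overline{\mathbb{R}^n}$ and a domain $G\subset\mathbb{R}^n$, $\Gamma(E,F,G)$ is the family of all curves $\gamma:[a,b]\to\overline{\mathbb{R}^n}$ with $\gamma(a)\in E$, $\gamma(b)\in F$ and $\gamma(t)\in G$ for $t\in(a,b)$. For $f:D\to\mathbb{R}^n$, $y_0\in f(D)$ and $0<r_1<r_2<\infty$, $\Gamma_f(y_0,r_1,r_2)$ is the family of all curves $\gamma$ in $D$ such that $f(\gamma)=f\circ\gamma\in\Gamma(S(y_0,r_1),S(y_0,r_2),A(y_0,r_1,r_2))$.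 Inverse Poletsky inequality: $f$ satisfies the inverse Poletsky inequality with the function $Q$ at $y_0\in f(D)$ if for all $0<r_1<r_2<\infty$ $$M(\Gamma_f(y_0,r_1,r_2))\leqslant\int_{f(D)}Q(y)\cdot\eta^n(|y-y_0|)\,dm(y)$$ for every Lebesgue measurable $\eta:(r_1,r_2)\to[0,\infty]$ with $\int_{r_1}^{r_2}\eta(r)\,dr\geqslant1$; here $\eta$ is extended by $0$ outside $(r_1,r_2)$. *)

(* Defs.v *)
From HB Require Import structures.
From mathcomp Require Import all_boot all_order all_algebra.
From mathcomp Require Import all_classical all_reals all_analysis measurable_realfun.

Set Implicit Arguments.
Unset Strict Implicit.
Unset Printing Implicit Defensive.

Import Order.TTheory GRing.Theory Num.Theory.
Import numFieldNormedType.Exports.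

Local Open Scope classical_set_scope.
Local Open Scope ring_scope.

(** R^n is ['rV[R]_n]. The library norm there is the sup norm: it induces the
    usual topology, but every metric notion below uses [enorm] instead. *)

Section euclidean.
Context {R : realType} {n : nat}.
Implicit Types (x y : 'rV[R]_n) (r : R) (A : set 'rV[R]_n).

Definition enorm x : R := Num.sqrt (\sum_(i < n) x ord0 i ^+ 2).

Definition eball x r := [set y | enorm (y - x) < r].

Definition esphere x r := [set y | enorm (y - x) = r].

Definition annulus x (r1 r2 : R) := [set y | r1 < enorm (y - x) < r2].

(* [+oo] when [A] is empty *)
Definition edistance x A : \bar R :=
  ereal_inf [set (enorm (x - y))%:E | y in A].

Definition frontier A := closure A `\` interior A.

Definition is_domain A := [/\ A !=set0, open A & connected A].

End euclidean.

(** n-dimensional Lebesgue measure: the Caratheodory restriction of the outer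
    measure given by countable coverings by half-open boxes. *)

Section lebesgue_Rn.
Context {R : realType} {n : nat}.
Local Open Scope ereal_scope.

Definition box (p : 'rV[R]_n * 'rV[R]_n) : set 'rV[R]_n :=
  [set x | forall i, (p.1 ord0 i < x ord0 i <= p.2 ord0 i)%R].

Definition box_volume (p : 'rV[R]_n * 'rV[R]_n) : R :=
  (\prod_(i < n) Num.max 0 (p.2 ord0 i - p.1 ord0 i))%R.

Definition box_cover (A : set 'rV[R]_n) : set (set ('rV[R]_n * 'rV[R]_n)) :=
  [set F | countable F /\ A `<=` \bigcup_(p in F) box p].

Definition lebesgue_outer (A : set 'rV[R]_n) : \bar R :=
  ereal_inf [set \esum_(p in F) (box_volume p)%:E | F in box_cover A].

Lemma box_volume_ge0 p : 0 <= (box_volume p)%:E.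
Proof. by rewrite lee_fin; apply: prodr_ge0 => i _; rewrite le_max lexx. Qed.

Let lebesgue_outer_ge0 A : 0 <= lebesgue_outer A.
Proof.
apply: le_ereal_inf_tmp => _ [F _ <-]; apply: esum_ge0 => p _.
exact: box_volume_ge0.
Qed.

Let lebesgue_outer0 : lebesgue_outer set0 = 0.
Proof.
apply/eqP; rewrite eq_le lebesgue_outer_ge0 andbT.
by apply: ereal_inf_lbound; exists set0; rewrite ?esum_set0; split.
Qed.

Let le_lebesgue_outer :
  {homo lebesgue_outer : A B / A `<=` B >-> A <= B}.
Proof.
move=> A B AB; apply: ereal_inf_le_tmp => _ [F [cF BF] <-].
by exists F => //; split => //; exact: subset_trans BF.
Qed.

Let lebesgue_outer_sigma_subadditive : sigma_subadditive lebesgue_outer.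
Proof.
move=> A; have [[i ioo]|] := pselect (exists i, lebesgue_outer (A i) = +oo).
  rewrite (eseries_pinfty _ _ ioo) ?leey// => k _.
  by rewrite -ltNye (lt_le_trans _ (lebesgue_outer_ge0 _)).
rewrite -forallNE => Aoo.
apply/lee_addgt0Pr => e e0.
apply: (le_trans _ (epsilon_trick _ _ (ltW e0))) => //.
pose P k F := box_cover (A k) F /\ \esum_(p in F) (box_volume p)%:E <=
  lebesgue_outer (A k) + (e / (2 ^ k.+1)%:R)%:E.
have [G PG] : {G : nat -> set ('rV[R]_n * 'rV[R]_n) & forall k, P k (G k)}.
  apply: (@choice _ _ P) => k.
  have fA : lebesgue_outer (A k) \is a fin_num.
    by rewrite ge0_fin_numE// ltey; apply/eqP/Aoo.
  have ek : (0 < e / (2 ^ k.+1)%:R)%R by rewrite divr_gt0// ltr0n expn_gt0.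
  have [_ [F cF <-] /ltW leF] := lb_ereal_inf_adherent ek fA.
  by exists F.
apply: (@le_trans _ _ (\esum_(p in \bigcup_k G k) (box_volume p)%:E)).
  apply: ereal_inf_lbound; exists (\bigcup_k G k) => //; split.
    by apply: bigcup_countable => // k _; have [[]] := PG k.
  move=> x [k _ Akx]; have [[_ /(_ _ Akx)[p Gp px]] _] := PG k.
  by exists p => //; exists k.
rewrite seqDU_bigcup_eq esum_bigcupT//; last first.
  by move=> p; exact: box_volume_ge0.
rewrite -nneseries_esumT; last first.
  by move=> k; apply: esum_ge0 => p _; exact: box_volume_ge0.
apply: lee_nneseries => [k _ _|k _].
  by apply: esum_ge0 => p _; exact: box_volume_ge0.
apply: le_trans (PG k).2; rewrite [leLHS]esum_mkcond [leRHS]esum_mkcond.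
apply: le_esum => p _; case: ifPn => [pG|_].
  by rewrite (mem_set (subset_seqDU (set_mem pG))).
by case: ifP => // _; exact: box_volume_ge0.
Qed.

HB.instance Definition _ := isOuterMeasure.Build R 'rV[R]_n lebesgue_outer
  lebesgue_outer0 lebesgue_outer_ge0 le_lebesgue_outer
  lebesgue_outer_sigma_subadditive.

End lebesgue_Rn.

(* R^n with the sigma-algebra of Lebesgue measurable sets *)
Notation lebesgueRn R n := (caratheodory_type (@lebesgue_outer R n)).

Definition lebesgue_measureRn {R : realType} {n : nat} :
  set (lebesgueRn R n) -> \bar R := @lebesgue_outer R n.

HB.instance Definition _ (R : realType) (n : nat) :=
  isMeasure.Build _ _ _ (@lebesgue_measureRn R n)
    (caratheodory_measure0 (@lebesgue_outer R n))
    (caratheodory_measure_ge0 (mu := @lebesgue_outer R n))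
    (@caratheodory_measure_sigma_additive _ _ (@lebesgue_outer R n)).

(* R with the sigma-algebra of Lebesgue measurable sets, on which the
   library's [completed_lebesgue_measure] is defined *)
Notation lebesgueR R := (caratheodory_type ((wlength (@idfun R))^*)%mu).

(* R^n with its Borel sigma-algebra *)
Notation borelRn R n := (g_sigma_algebraType (@open 'rV[R]_n)).

(** A parametrized path [a, b] -> T; the values of [pfun] outside [a, b] are
    irrelevant. *)
Record ppath (R : realType) (T : Type) :=
  PPath { pbeg : R; pend : R; pfun : R -> T }.

Section paths.
Context {R : realType}.

Definition is_curve {T : topologicalType} (g : ppath R T) :=
  pbeg g < pend g /\ {within `[pbeg g, pend g], continuous (pfun g)}.

Definition curve_in {T : topologicalType} (D : set T) (g : ppath R T) :=
  is_curve g /\ forall t, pbeg g <= t <= pend g -> D (pfun g t).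

Definition map_ppath {T U : Type} (f : T -> U) (g : ppath R T) : ppath R U :=
  PPath (pbeg g) (pend g) (f \o pfun g).

End paths.

Section modulus.
Context {R : realType} {n : nat}.
Local Open Scope ereal_scope.

(* length of the restriction of [g] to [c, d] *)
Definition path_length (g : ppath R 'rV[R]_n) (c d : R) : \bar R :=
  ereal_sup [set (let F := pfun g \o nth d (c :: s) in
      \sum_(0 <= k < size s) enorm (F k.+1 - F k))%R%:E
    | s in itv_partition c d].

Definition locally_rectifiable (g : ppath R 'rV[R]_n) :=
  forall c d : R, (pbeg g <= c)%R -> (c <= d)%R -> (d <= pend g)%R ->
    path_length g c d < +oo.

(* the arc-length parametrization: its value at [s] does not depend on which
   parameter [t] with length of [g] on [pbeg g, t] equal to [s] is chosen *)
Definition normal_representation (g : ppath R 'rV[R]_n) (s : R) : 'rV[R]_n :=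
  pfun g (xget (pbeg g) [set t | (pbeg g <= t <= pend g)%R /\
                                 path_length g (pbeg g) t = s%:E]).

Definition line_integral (rho : 'rV[R]_n -> \bar R) (g : ppath R 'rV[R]_n) :=
  \int[lebesgue_measure]_(s in `[0%R, fine (path_length g (pbeg g) (pend g))])
    rho (normal_representation g s).

Definition admissible (Gamma : set (ppath R 'rV[R]_n))
    (rho : 'rV[R]_n -> \bar R) :=
  [/\ forall x, 0 <= rho x,
      measurable_fun setT (rho : borelRn R n -> \bar R) &
      forall g, Gamma g -> locally_rectifiable g -> 1 <= line_integral rho g].

Definition modulus (Gamma : set (ppath R 'rV[R]_n)) : \bar R :=
  ereal_inf [set \int[lebesgue_measureRn]_x (rho x ^+ n)
            | rho in admissible Gamma].

End modulus.

Section inverse_poletsky.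
Context {R : realType} {n : nat}.
Implicit Types (D : set 'rV[R]_n) (f : 'rV[R]_n -> 'rV[R]_n)
  (Q : 'rV[R]_n -> \bar R).

Local Notation Rnbar := (one_point_compactification 'rV[R]_n).

(* Gamma(E, F, G), the point at infinity of [Rnbar] being [None] *)
Definition joining_curves (E F : set Rnbar) (G : set 'rV[R]_n) : set (ppath R Rnbar) :=
  [set g | [/\ is_curve g, E (pfun g (pbeg g)), F (pfun g (pend g)) &
    forall t, pbeg g < t < pend g -> (Some @` G) (pfun g t)]].

(* Gamma_f(y0, r1, r2) *)
Definition preimage_curves D f (y0 : 'rV[R]_n) (r1 r2 : R)
    : set (ppath R 'rV[R]_n) :=
  [set g | curve_in D g /\
    joining_curves (Some @` esphere y0 r1) (Some @` esphere y0 r2)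
      (annulus y0 r1 r2) (map_ppath (Some \o f) g)].

Local Open Scope ereal_scope.

Definition inverse_poletsky D f Q (y0 : 'rV[R]_n) :=
  forall r1 r2 : R, (0 < r1)%R -> (r1 < r2)%R ->
  forall eta : R -> \bar R,
    (forall r, (r1 < r < r2)%R -> 0 <= eta r) ->
    measurable_fun (`]r1, r2[ : set (lebesgueR R)) eta ->
    1 <= \int[completed_lebesgue_measure]_(r in `]r1, r2[) eta r ->
  modulus (preimage_curves D f y0 r1 r2) <=
  \int[lebesgue_measureRn]_(y in f @` D)
    (Q y * (patch (cst 0) (`]r1, r2[) eta (enorm (y - y0))) ^+ n).

Definition open_mapping D f :=
  forall U, U `<=` D -> open U -> open (f @` U).

Definition discrete_mapping D f :=
  forall y, D `&` f @^-1` [set y] `<=` isolated (D `&` f @^-1` [set y]).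

(* Maps D -> R^n are represented by total functions; none of the conditions
   depends on the values outside [D]. *)
Definition poletsky_family D Q : set ('rV[R]_n -> 'rV[R]_n) :=
  [set f | [/\ {within D, continuous f}, open_mapping D f,
    discrete_mapping D f &
    forall y0, (f @` D) y0 -> inverse_poletsky D f Q y0]].

End inverse_poletsky.

(* Main.v *)
Require Import Defs.
From HB Require Import structures.
From mathcomp Require Import all_boot all_order all_algebra.
From mathcomp Require Import all_classical all_reals all_analysis measurable_realfun.
From mathcomp Require Import ring lra zify.

Import Order.TTheory GRing.Theory Num.Theory.
Import numFieldNormedType.Exports.

Local Open Scope classical_set_scope.
Local Open Scope ring_scope.

Set Implicit Arguments.
Unset Strict Implicit.
Unset Printing Implicit Defensive.

(** Let d be the Euclidean distance of [f x] and [f x0], and suppose d > 0. In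
    a shell around [x0] many curves join the points over one ray to the points
    over another ray, so they form a family of large modulus, and the inverse
    Poletsky inequality makes this modulus small.

    Rays instead of path lifting. One ray starts at [f x] in the direction
    [f x - f x0], the other one at [f x0] in the opposite direction. As [f] is
    open and a ray is connected and unbounded, the points over either ray meet
    the boundary of each cube around [x0] that contains [x] and lies in [D]
    ([ray_meets_cube_boundary]). If p lies over the first ray and q over the
    second one, then the distances of [f p] and [f q] to a center y differ by at
    least d, for y = [f x] or y = [f x0].

    Upper bound. The rings of width h = d / 12 around a center are disjoint, so
    [ring_weights] adds up near-optimal weights for all of them into a function
    g with integral at most h^-n |Q|_1 + eps. A segment over which the distance
    to the center changes by 2 h contains a curve that joins the two boundary
    spheres of a ring; the line integral of some weight along it is then at
    least 1 ([segment_oscillation]). The use of all rings is forced by the rays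
    being unbounded; the use of single segments instead of polygons costs only
    the factor 12.

    Lower bound. Let t be half the side of the cube. A point u of the unit cube
    determines points of all faces, namely its projections, and a polygon of at
    most six segments in the faces that runs from p to its projection, passes
    from face to face across edges, and ends in q. If the mean over u of the
    costs of these segments is less than 1, then some u gives a polygon along
    which the distance to the center changes by less than 12 h = d, which is
    impossible. The mean is bounded through the integral of g over the faces:
    the segments from p to the points of a face concentrate at p, but the
    exponent n exceeds the dimension n - 1 of the faces, so that the weight
    s^(1/n - 1) in Young's inequality is integrable ([integral_weight_le],
    [integral_segment_cost_le]). Hence the integral of g over the boundary of
    the cube is at least c / t ([face_lower_bound]), and integration over t
    gives c log (t1 / t0) <= |g|_1 ([shell_lower_bound]).

    Both bounds yield d^n log (t1 / t0) <= C |Q|_1 ([distortion_estimate]) if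
    [x] is close to [x0] compared with the size of the cubes; a chain of points
    gives the rest ([log_hoelder]). No formula for integrals in coordinates is
    needed beyond inequalities, and these follow from a comparison on boxes
    ([ge0_integral_le_boxes]). *)

(** * Boxes and Borel sets *)

Section countable_covers.
Context {R : realType} {T : pointedType} {U : Type}.
Local Open Scope ereal_scope.

(** Reduces coverings by arbitrary countable families to sequences; a sequence
    is also obtained when the family is finite, by padding with empty sets. *)
Lemma esum_enum (F : set T) (a : T -> \bar R) (B : T -> set U) :
  countable F -> (forall p, 0 <= a p) ->
  exists A : (set U)^nat, exists e : nat -> T,
    [/\ \bigcup_k A k = \bigcup_(p in F) B p,
        forall k, A k = set0 \/ A k = B (e k) &
        forall m : set U -> \bar R, m set0 = 0 ->
          (forall p, 0 <= m (B p)) -> (forall p, F p -> m (B p) <= a p) ->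
          \sum_(k <oo) m (A k) <= \esum_(p in F) a p].
Proof.
move=> /countable_bijP[P]; rewrite card_eq_sym => /card_set_bijP[e [eF einj esurj]] a0.
exists (fun k => if k \in P then B (e k) else set0), e; split.
- apply/seteqP; split=> [x [k _]|x [p Fp Bx]].
    by case: ifPn => // /set_mem Pk Bx; exists (e k) => //; exact: eF.
  by have [k Pk ekp] := esurj _ Fp; exists k => //; rewrite mem_set// ekp.
- by move=> k; case: ifPn => _; [right|left].
- move=> m m0 mge0 ma.
  have -> : F = [set e x | x in P].
    by apply/seteqP; split=> [p /esurj//|p [k Pk <-]]; exact: eF.
  rewrite esum_set_image// [leRHS]eseries_mkcond.
  apply: lee_nneseries => [k _ _|k _]; first by case: ifPn => _; rewrite ?m0.
  by case: ifPn => [/set_mem Pk|_]; [apply/ma/eF|rewrite m0].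
Qed.

End countable_covers.

Section boxes.
Context {R : realType} {n : nat}.
Local Open Scope ereal_scope.
Implicit Types (p : 'rV[R]_n * 'rV[R]_n) (x : 'rV[R]_n).

Lemma lebesgue_outer_box_le p : lebesgue_outer (box p) <= (box_volume p)%:E.
Proof.
apply: ereal_inf_lbound; exists [set p]; last first.
  by rewrite esum_set1// box_volume_ge0.
by split; [exact: countable1|move=> x px; exists p].
Qed.

Let cut_low (i : 'I_n) (c : R) p : 'rV[R]_n * 'rV[R]_n :=
  (p.1, \row_j if j == i then Num.min c (p.2 ord0 j) else p.2 ord0 j)%R.

Let cut_high (i : 'I_n) (c : R) p : 'rV[R]_n * 'rV[R]_n :=
  (\row_j (if j == i then Num.max c (p.1 ord0 j) else p.1 ord0 j), p.2)%R.

Let box_cut_low i c p :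
  box p `&` [set x | (x ord0 i <= c)%R] = box (cut_low i c p).
Proof.
apply/seteqP; split=> x /=.
  move=> [px xc] j; rewrite /cut_low /= mxE; case: eqP => [->|_]; last exact: px.
  by have /andP[-> pi] := px i; rewrite le_min xc.
move=> H; split=> [j|]; last first.
  by have := H i; rewrite /cut_low /= mxE eqxx le_min => /andP[_ /andP[]].
have := H j; rewrite /cut_low /= mxE; case: eqP => // _.
by rewrite le_min => /andP[-> /andP[]].
Qed.

Let box_cut_high i c p :
  box p `&` ~` [set x | (x ord0 i <= c)%R] = box (cut_high i c p).
Proof.
apply/seteqP; split=> x /=.
  move=> [px /negP]; rewrite -ltNge => xc j; rewrite /cut_high /= mxE.
  case: eqP => [->|_]; last exact: px.
  by have /andP[pi ->] := px i; rewrite gt_max xc pi.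
move=> H; split=> [j|]; last first.
  have := H i; rewrite /cut_high /= mxE eqxx gt_max => /andP[/andP[xc _] _].
  by apply/negP; rewrite -ltNge.
have := H j; rewrite /cut_high /= mxE; case: eqP => // _.
by rewrite gt_max => /andP[/andP[_ ->]].
Qed.

Let box_volume_cut i c p :
  (box_volume (cut_low i c p) + box_volume (cut_high i c p) <= box_volume p)%R.
Proof.
have volE q : box_volume q = (Num.max 0 (q.2 ord0 i - q.1 ord0 i) *
    \prod_(j | j != i) Num.max 0 (q.2 ord0 j - q.1 ord0 j))%R.
  by rewrite /box_volume (bigD1 i).
rewrite !volE /= !mxE !eqxx.
under eq_bigr => j ji do rewrite mxE (negbTE ji).
under [X in (_ + _ * X)%R]eq_bigr => j ji do rewrite mxE (negbTE ji).
rewrite -mulrDl ler_wpM2r//.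
  by apply: prodr_ge0 => j _; rewrite le_max lexx.
rewrite /Num.max /Num.min; do ![case: ltP => ?]; lra.
Qed.

(** A half-space cuts a box into two boxes whose volumes add up, so it cuts any
    covering by boxes into two coverings of the same total volume. *)
Lemma measurable_halfspace (i : 'I_n) (c : R) :
  measurable ([set x | (x ord0 i <= c)%R] : set (lebesgueRn R n)).
Proof.
apply: le_caratheodory_measurable => X.
set A := [set x | _].
apply: le_ereal_inf_tmp => _ [F [cF XF] <-].
have outer_esum (B : set 'rV[R]_n) (v : 'rV[R]_n * 'rV[R]_n -> R) :
    (forall p, lebesgue_outer (box p `&` B) <= (v p)%:E) ->
    lebesgue_outer (X `&` B) <= \esum_(p in F) (v p)%:E.
  move=> Bv.
  have v0 p : 0 <= (v p)%:E by exact: le_trans (outer_measure_ge0 _ _) (Bv p).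
  have [G [e [GF _ sG]]] := esum_enum (fun p => box p `&` B) cF v0.
  have sG' := sG (@lebesgue_outer R n) (outer_measure0 _)
    (fun p => outer_measure_ge0 _ _) (fun p _ => Bv p).
  apply: le_trans sG'; apply: le_trans (outer_measure_sigma_subadditive _ G).
  apply: le_outer_measure; rewrite GF => x [Xx Bx].
  by have [p Fp px] := XF _ Xx; exists p.
apply: (@le_trans _ _ (\esum_(p in F) (box_volume (cut_low i c p))%:E +
                       \esum_(p in F) (box_volume (cut_high i c p))%:E)).
  apply: leeD; apply: outer_esum => p.
    by rewrite box_cut_low; exact: lebesgue_outer_box_le.
  by rewrite box_cut_high; exact: lebesgue_outer_box_le.
rewrite -esumD; [|by move=> p _; exact: box_volume_ge0..].
by apply: le_esum => p _; rewrite -EFinD lee_fin box_volume_cut.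
Qed.

End boxes.

Section borel_Rn.
Context {R : realType} {n : nat}.
Implicit Types (p : 'rV[R]_n * 'rV[R]_n) (x : 'rV[R]_n).

Definition ratvec (v : 'rV[rat]_n) : 'rV[R]_n := map_mx ratr v.

Lemma open_bigcup_boxes (U : set 'rV[R]_n) : open U ->
  U = \bigcup_(v in [set v : 'rV[rat]_n * 'rV[rat]_n |
         box (ratvec v.1, ratvec v.2) `<=` U]) box (ratvec v.1, ratvec v.2).
Proof.
move=> oU; apply/seteqP; split=> [x Ux|x [v /= vU /vU//]].
have /nbhs_ballP[e /= e0 xeU] : nbhs x U by exact: open_nbhs_nbhs.
have lo i : {q : rat | x ord0 i - e < ratr q < x ord0 i}.
  apply: cid; have /rat_in_itvoo[q] : x ord0 i - e < x ord0 i by rewrite ltrBlDr ltrDl.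
  by rewrite in_itv/= => ?; exists q.
have hi i : {q : rat | x ord0 i < ratr q < x ord0 i + e}.
  apply: cid; have /rat_in_itvoo[q] : x ord0 i < x ord0 i + e by rewrite ltrDl.
  by rewrite in_itv/= => ?; exists q.
exists (\row_i sval (lo i), \row_i sval (hi i)).
  move=> y /= yb; apply: xeU; split => // i j.
  rewrite (ord1 i); have := yb j; rewrite !mxE.
  case: (lo j) => q /= /andP[q1 q2]; case: (hi j) => r /= /andP[r1 r2] /andP[y1 y2].
  by rewrite /ball/= ltr_norml; apply/andP; split; lra.
move=> i; rewrite !mxE.
by case: (lo i) => q /= /andP[q1 ->]; case: (hi i) => r /= /andP[/ltW ->].
Qed.

Lemma measurable_coord (i : 'I_n) :
  measurable_fun setT (fun x : borelRn R n => x ord0 i : R).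
Proof.
apply: (measurability _ (RGenOInfty.measurableE R)) => _ [_ [c ->] <-].
rewrite setTI; apply: sub_sigma_algebra; apply: open_comp => [x _|].
  exact: coord_continuous.
exact: interval_open.
Qed.

Lemma measurable_coord_lebesgue (i : 'I_n) :
  measurable_fun setT (fun x : lebesgueRn R n => x ord0 i : R).
Proof.
apply: (measurability _ (RGenOInfty.measurableE R)) => _ [_ [c ->] <-].
rewrite setTI (_ : _ @^-1` _ = ~` [set x : 'rV[R]_n | (x ord0 i <= c)%R]).
  by apply: measurableC; exact: measurable_halfspace.
by apply/seteqP; split=> x /=; rewrite in_itv/= andbT ltNge => /negP.
Qed.

Lemma box_bigcap p : box p = \bigcap_(i in [set: 'I_n])
  (fun x : 'rV[R]_n => x ord0 i) @^-1` `]p.1 ord0 i, p.2 ord0 i]%classic.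
Proof.
apply/seteqP; split=> t /=; first by move=> H i _; rewrite /= in_itv/=; exact: H.
by move=> H i; have := H i I; rewrite /= in_itv.
Qed.

Lemma measurable_preimage_box d (T : measurableType d) (f : T -> 'rV[R]_n) p :
  (forall i, measurable_fun setT (fun t => f t ord0 i : R)) ->
  measurable (f @^-1` box p).
Proof.
move=> mf; rewrite box_bigcap preimage_bigcap; apply: fin_bigcap_measurable => // i _.
rewrite -[X in measurable X]setTI; apply: (mf i) => //.
Qed.

Lemma measurable_box p : measurable (box p : set (borelRn R n)).
Proof.
by apply: (@measurable_preimage_box _ (borelRn R n) id) => i; exact: measurable_coord.
Qed.

(** Every open set is a countable union of boxes with rational vertices. *)
Lemma measurable_fun_rV d (T : measurableType d) (f : T -> borelRn R n) :
  (forall i, measurable_fun setT (fun t => f t ord0 i : R)) ->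
  measurable_fun setT f.
Proof.
move=> mf.
apply: (@measurability _ _ _ (borelRn R n) _ _ (@open 'rV[R]_n)) => // _ [U oU <-].
rewrite setTI (open_bigcup_boxes oU) preimage_bigcup.
rewrite bigcup_mkcond.
apply: countable_bigcupT_measurable => [|v]; first exact: countableP.
by case: ifP => // _; exact: measurable_preimage_box.
Qed.

Lemma measurable_lebesgue_borel :
  measurable_fun setT (id : lebesgueRn R n -> borelRn R n).
Proof. by apply: measurable_fun_rV => i; exact: measurable_coord_lebesgue. Qed.

Lemma borel_lebesgue_measurable (A : set (borelRn R n)) :
  measurable A -> measurable (A : set (lebesgueRn R n)).
Proof.
move=> mA; rewrite (_ : A = setT `&` id @^-1` A); last by rewrite setTI.
exact: measurable_lebesgue_borel.
Qed.

End borel_Rn.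

(** * Comparison of measures on boxes *)

Section borel_measure.
Context {R : realType} {n : nat}.
Local Open Scope ereal_scope.
Implicit Types (p : 'rV[R]_n * 'rV[R]_n) (x : 'rV[R]_n).

(** The same outer measure, read on the Borel sets: the functions that occur
    are Borel, a property that is stable under composition. *)
Definition borel_measureRn : set (borelRn R n) -> \bar R := @lebesgue_outer R n.

Let borel_measure0 : borel_measureRn set0 = 0.
Proof. exact: outer_measure0. Qed.

Let borel_measure_ge0 A : 0 <= borel_measureRn A.
Proof. exact: outer_measure_ge0. Qed.

Let borel_measure_semi_sigma_additive : semi_sigma_additive borel_measureRn.
Proof.
move=> F mF tF mUF.
apply: (@measure_semi_sigma_additive _ _ _ (@lebesgue_measureRn R n)) => //.
  by move=> k; exact: borel_lebesgue_measurable.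
exact: borel_lebesgue_measurable.
Qed.

HB.instance Definition _ := isMeasure.Build _ _ _ borel_measureRn
  borel_measure0 borel_measure_ge0 borel_measure_semi_sigma_additive.

Lemma borel_measure_box_le p : borel_measureRn (box p) <= (box_volume p)%:E.
Proof. exact: lebesgue_outer_box_le. Qed.

Definition cube (r : R) : set (borelRn R n) := box (const_mx (- r), const_mx r)%R.

Lemma cubeP (r : R) x : cube r x <-> forall i, (- r < x ord0 i <= r)%R.
Proof. by split=> H i; have := H i; rewrite /= !mxE. Qed.

Lemma measurable_cube r : measurable (cube r).
Proof. exact: measurable_box. Qed.

Let borel_sigma_finite : sigma_finite setT borel_measureRn.
Proof.
exists (fun k => cube k%:R); last first.
  move=> k; split; first exact: measurable_cube.
  by apply: le_lt_trans (borel_measure_box_le _) _; rewrite ltry.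
apply/seteqP; split=> // x _.
have [k xk] : exists k : nat, (`|x| < k%:R)%R.
  by exists (Num.truncn `|x|).+1; rewrite truncnS_gt.
exists k => //; apply/cubeP => i.
have xi : (`|x ord0 i| <= `|x|)%R.
  rewrite [leRHS]/Num.norm/= mx_normrE; apply/bigmax_geP; right.
  by exists (ord0, i).
by have := le_lt_trans xi xk; rewrite ltr_norml => /andP[-> /ltW].
Qed.

HB.instance Definition _ := Measure_isSigmaFinite.Build _ _ _ borel_measureRn
  borel_sigma_finite.

Lemma ge0_integral_borel (h : 'rV[R]_n -> \bar R) :
  (forall x, 0 <= h x) -> measurable_fun setT (h : borelRn R n -> \bar R) ->
  \int[lebesgue_measureRn]_x h x = \int[borel_measureRn]_x h x.
Proof.
move=> h0 mh; have := @ge0_integral_pushforward _ _ _ _ _ _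
  (@measurable_lebesgue_borel R n) (@lebesgue_measureRn R n) setT h measurableT mh.
by rewrite preimage_setT => <- // x _; exact: h0.
Qed.

(** Lebesgue measure is the largest one with this bound on boxes, being an
    infimum over coverings by boxes. *)
Lemma le_borel_measure (mu : {measure set (borelRn R n) -> \bar R}) :
  (forall p, mu (box p) <= (box_volume p)%:E) ->
  forall A, measurable A -> mu A <= borel_measureRn A.
Proof.
move=> mub A mA; apply: le_ereal_inf_tmp => _ [F [cF AF] <-].
have [G [e [GF GB sG]]] := @esum_enum R _ _ F _ (fun p => box p) cF (@box_volume_ge0 R n).
apply: le_trans (sG mu (measure0 mu) (fun p => measure_ge0 mu _) (fun p _ => mub p)).
apply: measure_sigma_subadditive => //; last by rewrite GF.
by move=> k; case: (GB k) => ->; [exact: measurable0|exact: measurable_box].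
Qed.

(** To bound an integral under a change of variables, it is enough to measure
    the preimages of boxes. *)
Lemma ge0_integral_le_boxes d (X : measurableType d)
    (P : {measure set X -> \bar R}) (S : set X) (Phi : X -> borelRn R n) (K : R) :
  measurable S -> measurable_fun setT Phi -> (0 < K)%R ->
  (forall p, P (Phi @^-1` box p `&` S) <= (K * box_volume p)%:E) ->
  forall h : 'rV[R]_n -> \bar R, (forall x, 0 <= h x) ->
    measurable_fun setT (h : borelRn R n -> \bar R) ->
    \int[P]_(x in S) h (Phi x) <= K%:E * \int[borel_measureRn]_x h x.
Proof.
move=> mS mPhi K0 Pbox h h0 mh.
pose PS : {measure set X -> \bar R} := mrestr P mS.
pose nu : {measure set (borelRn R n) -> \bar R} :=
  measure_function_pushforward__canonical__measure_function_Measure PS mPhi.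
have K0' : (0 <= K^-1)%R by rewrite invr_ge0 ltW.
have nuE : \int[PS]_x h (Phi x) = \int[nu]_x h x.
  have := @ge0_integral_pushforward _ _ _ _ _ _ mPhi PS setT h measurableT mh.
  by rewrite preimage_setT => -> // x _; exact: h0.
have mhPhi : measurable_fun setT (h \o Phi) by exact: measurableT_comp.
have -> : \int[P]_(x in S) h (Phi x) = \int[PS]_(x in S) h (Phi x).
  apply: eq_measure_integral => A mA AS.
  by rewrite /PS /= /mrestr setIidl.
apply: (@le_trans _ _ (\int[PS]_x h (Phi x))).
  by apply: ge0_subset_integral => //=; exact: measurable_funTS.
rewrite nuE.
have := @ge0_le_measure_integral _ _ _
   (mscale (NngNum K0') nu : {measure set _ -> \bar R}) borel_measureRn _ h setT.
rewrite ge0_integral_mscale//= => H.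
rewrite -lee_pdivrMl//; apply: H => //.
apply: le_borel_measure => p; rewrite /mscale /= lee_pdivrMl//.
by rewrite -EFinM; exact: Pbox.
Qed.

End borel_measure.

(** * Slices and changes of variables *)

Section cube_measure.
Context {R : realType}.
Local Open Scope ereal_scope.

Lemma box_volumeM n (p : 'rV[R]_n * 'rV[R]_n) i :
  box_volume p = (Num.max 0 (p.2 ord0 i - p.1 ord0 i) *
    \prod_(j | j != i) Num.max 0 (p.2 ord0 j - p.1 ord0 j))%R.
Proof. by rewrite /box_volume (bigD1 i). Qed.

Lemma lebesgue_measure_ocitv (a b : R) :
  lebesgue_measure `]a, b]%classic = (Num.max 0 (b - a))%:E.
Proof.
rewrite lebesgue_measure_itv /= lte_fin; case: ifPn => [ab|].
  by rewrite -EFinB max_r// subr_ge0 ltW.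
by rewrite -leNgt => ba; rewrite max_l// subr_le0.
Qed.

Lemma lebesgue_measure_coitv (a b : R) :
  lebesgue_measure `[a, b[%classic = (Num.max 0 (b - a))%:E.
Proof.
rewrite lebesgue_measure_itv /= lte_fin; case: ifPn => [ab|].
  by rewrite -EFinB max_r// subr_ge0 ltW.
by rewrite -leNgt => ba; rewrite max_l// subr_le0.
Qed.

Let consv n (z : measurableTypeR R * borelRn R n) : borelRn R n.+1 :=
  \row_j (if unlift ord0 j is Some k then z.2 ord0 k else z.1).

Let consv0 n (z : measurableTypeR R * borelRn R n) : consv z ord0 ord0 = z.1.
Proof. by rewrite mxE unlift_none. Qed.

Let consvS n (z : measurableTypeR R * borelRn R n) k :
  consv z ord0 (lift ord0 k) = z.2 ord0 k.
Proof. by rewrite mxE liftK. Qed.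

Let measurable_consv n : measurable_fun setT (@consv n).
Proof.
apply: measurable_fun_rV => i; case: (unliftP ord0 i) => [k ->|->].
  rewrite (_ : (fun _ => _) = (fun u : borelRn R n => u ord0 k : R) \o snd).
    by apply: measurableT_comp => //; exact: measurable_coord.
  by apply/funext => z; rewrite consvS.
rewrite (_ : (fun _ => _) = fst) => [|]; first exact: measurable_fst.
by apply/funext => z; rewrite consv0.
Qed.

Let consv_box n (p : 'rV[R]_n.+1 * 'rV[R]_n.+1) :
  @consv n @^-1` box p = `]p.1 ord0 ord0, p.2 ord0 ord0]%classic `*`
    box (\row_k p.1 ord0 (lift ord0 k), \row_k p.2 ord0 (lift ord0 k)).
Proof.
apply/seteqP; split=> [z H|z [z1 z2] i].
  split; first by have := H ord0; rewrite consv0 /= in_itv.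
  by move=> k; have := H (lift ord0 k); rewrite consvS /= !mxE.
case: (unliftP ord0 i) => [k ->|->].
  by rewrite consvS; have := z2 k; rewrite /= !mxE.
by rewrite consv0; move: z1; rewrite /= in_itv.
Qed.

(** By induction: the product of the length and the measure in dimension n is
    at most the measure in dimension n + 1, by comparison on boxes. In
    dimension 0 a covering contains at least one box, of volume 1. *)
Lemma cube1_measure_gt0 n : 0 < borel_measureRn (cube 1 : set (borelRn R n)).
Proof.
elim: n => [|n IHn].
  apply: (@lt_le_trans _ _ 1%:E); first by rewrite lte_fin.
  apply: le_ereal_inf_tmp => _ [F [_ cubeF] <-].
  have [p Fp _] : (\bigcup_(p in F) box p) 0%R by apply: cubeF; case.
  apply: esum_ge; exists [set p]; first by split => // _ ->.
  by rewrite fsbig_set1 /box_volume big_ord0.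
pose P : {measure set _ -> \bar R} :=
  product_measure1 (@lebesgue_measure R) (@borel_measureRn R n).
pose nu : {measure set (borelRn R n.+1) -> \bar R} :=
  measure_function_pushforward__canonical__measure_function_Measure P (@measurable_consv n).
have nu_box p : nu (box p) = (Num.max 0 (p.2 ord0 ord0 - p.1 ord0 ord0))%:E *
    borel_measureRn (box (\row_k p.1 ord0 (lift ord0 k), \row_k p.2 ord0 (lift ord0 k))).
  rewrite /nu/= /pushforward consv_box product_measure1E//; last exact: measurable_box.
  by congr (_ * _); exact: lebesgue_measure_ocitv.
apply: (@lt_le_trans _ _ (nu (cube 1))); last first.
  apply: le_borel_measure; last exact: measurable_cube.
  move=> p; rewrite nu_box.
  apply: (le_trans (lee_wpmul2l _ (borel_measure_box_le _))).
    by rewrite lee_fin le_max lexx.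
  rewrite -EFinM lee_fin /box_volume big_ord_recl ler_wpM2l//.
    by rewrite le_max lexx.
  by rewrite le_eqVlt; apply/orP; left; apply/eqP/eq_bigr => k _; rewrite !mxE.
rewrite nu_box /= !mxE.
rewrite [X in borel_measureRn X](_ : _ = cube 1); last first.
  by congr box; congr pair; apply/rowP => k; rewrite !mxE.
by apply: mule_gt0 => //; rewrite lte_fin lt_max; apply/orP; right; lra.
Qed.

End cube_measure.

Section change_of_variables.
Context {R : realType} {n : nat}.
Local Open Scope ereal_scope.
Local Notation mB := (@borel_measureRn R n).
Implicit Types (u x : 'rV[R]_n) (g h : 'rV[R]_n -> \bar R).

Lemma ge0_integral_affine (a c : 'I_n -> R) (S : set (borelRn R n)) h :
  measurable S -> (forall j, (0 < c j)%R) ->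
  (forall x, 0 <= h x) -> measurable_fun setT (h : borelRn R n -> \bar R) ->
  \int[mB]_(u in S) h (\row_j (a j + c j * u ord0 j))%R <=
  ((\prod_j c j)^-1)%:E * \int[mB]_x h x.
Proof.
move=> mS c0 h0 mh.
have prodc0 : (0 < \prod_j c j)%R by apply: prodr_gt0 => j _.
apply: (@ge0_integral_le_boxes _ _ _ (borelRn R n) mB S
  (fun u => \row_j (a j + c j * u ord0 j))%R) => //; last 2 first.
- by rewrite invr_gt0.
- move=> p.
  pose q := (\row_j ((p.1 ord0 j - a j) / c j), \row_j ((p.2 ord0 j - a j) / c j))%R.
  apply: (@le_trans _ _ (mB (box q))).
    apply: le_outer_measure => u [/= ub _] j; rewrite /q /= !mxE.
    have := ub j; rewrite mxE => /andP[u1 u2].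
    by rewrite ltr_pdivrMr// ler_pdivlMr// mulrC; apply/andP; split; lra.
  apply: le_trans (borel_measure_box_le _) _.
  rewrite lee_fin /box_volume -prodfV -big_split/=.
  rewrite le_eqVlt; apply/orP; left; apply/eqP; apply: eq_bigr => j _; rewrite !mxE -mulrBl.
  by rewrite maxr_pMr ?invr_ge0 ?ltW// mulr0 mulrC; congr (Num.max _ (_ * _))%R; ring.
- apply: measurable_fun_rV => j.
  rewrite (_ : (fun _ => _) = (fun u : borelRn R n => a j + c j * u ord0 j)%R); last first.
    by apply/funext => u; rewrite mxE.
  apply: measurable_funD => //; apply: measurable_funM => //; exact: measurable_coord.
Qed.

Lemma measurable_shift (a : 'rV[R]_n) h :
  measurable_fun setT (h : borelRn R n -> \bar R) ->
  measurable_fun setT ((fun z => h (a + z)%R) : borelRn R n -> \bar R).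
Proof.
move=> mh; apply: (measurableT_comp mh); apply: measurable_fun_rV => j.
rewrite (_ : (fun _ => _) = (fun u : borelRn R n => a ord0 j + u ord0 j)%R); last first.
  by apply/funext => u; rewrite mxE.
by apply: measurable_funD => //; exact: measurable_coord.
Qed.

Definition upd (u : 'rV[R]_n) (i : 'I_n) (a : R) : 'rV[R]_n :=
  \row_j (if j == i then a else u ord0 j).

Definition slab (i : 'I_n) : set (borelRn R n) := [set u | -1 < u ord0 i <= 1]%R.

Lemma measurable_slab i : measurable (slab i).
Proof.
rewrite (_ : slab i = setT `&` (fun u : borelRn R n => u ord0 i : R) @^-1` [set` `]-1, 1]%R]).
  by apply: measurable_coord => //; exact: measurable_itv.
by rewrite setTI; apply/seteqP; split=> u /=; rewrite in_itv.
Qed.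

(** The integral over the hyperplane orthogonal to the [i]-th axis at distance
    [t], on the side given by [b]. The [i]-th coordinate of [u] has no influence
    on the integrand; it ranges over an interval of length 2 so that the
    integral can be taken in the same space for all faces. *)
Definition face_integral g (i : 'I_n) (b : bool) (t : R) : \bar R :=
  \int[mB]_(u in slab i) g (upd u i ((-1) ^+ b * t)%R).

Let face_map (i : 'I_n) (b : bool) (z : measurableTypeR R * borelRn R n) : borelRn R n :=
  upd z.2 i ((-1) ^+ b * z.1)%R.

Let measurable_face_map i b : measurable_fun setT (face_map i b).
Proof.
apply: measurable_fun_rV => j.
rewrite (_ : (fun _ => _) = (fun z : measurableTypeR R * borelRn R n =>
    if j == i then (-1) ^+ b * z.1 else z.2 ord0 j)%R); last first.
  by apply/funext => z; rewrite mxE.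
case: eqP => _; first by apply: measurable_funM => //; exact: measurable_fst.
by apply: (@measurableT_comp _ _ _ _ _ _ (fun u : borelRn R n => u ord0 j : R)) => //;
  exact: measurable_coord.
Qed.

Let face_fun g i b (z : measurableTypeR R * borelRn R n) : \bar R :=
  (g (face_map i b z)) * (\1_(slab i) z.2)%:E.

Let face_fun_ge0 g i b : (forall x, 0 <= g x) -> forall z, 0 <= face_fun g i b z.
Proof. by move=> g0 z; rewrite mule_ge0// lee_fin indicE; case: (_ \in _). Qed.

Let measurable_face_fun g i b : measurable_fun setT (g : borelRn R n -> \bar R) ->
  measurable_fun setT (face_fun g i b).
Proof.
move=> mg; apply: emeasurable_funM; first exact: measurableT_comp.
apply/measurable_EFinP; apply: measurableT_comp => //.
by apply: measurable_indic; exact: measurable_slab.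
Qed.

Let face_integralE g i b t : (forall x, 0 <= g x) ->
  face_integral g i b t = \int[mB]_u face_fun g i b (t, u).
Proof.
move=> g0; rewrite /face_integral integral_mkcond; apply: eq_integral => u _.
rewrite /face_fun /= patchE indicE; case: ifPn => ?.
  by rewrite mule1.
by rewrite mule0.
Qed.

Lemma face_integral_ge0 g i b t : (forall x, 0 <= g x) -> 0 <= face_integral g i b t.
Proof. by move=> g0; exact: integral_ge0. Qed.

Lemma measurable_face_integral g i b :
  (forall x, 0 <= g x) -> measurable_fun setT (g : borelRn R n -> \bar R) ->
  measurable_fun setT (face_integral g i b).
Proof.
move=> g0 mg.
rewrite (_ : face_integral g i b = fubini_F mB (face_fun g i b)); last first.
  by apply/funext => t; rewrite face_integralE.
apply: (@measurable_fun_fubini_tonelli_F _ _ (measurableTypeR R) (borelRn R n) R).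
- exact: measurable_face_fun.
- exact: face_fun_ge0.
Qed.

(** Fubini, up to the length 2 of the dummy coordinate. *)
Lemma integral_face_integral_le g i b :
  (forall x, 0 <= g x) -> measurable_fun setT (g : borelRn R n -> \bar R) ->
  \int[lebesgue_measure]_t face_integral g i b t <= 2%:E * \int[mB]_x g x.
Proof.
move=> g0 mg.
pose P : {measure set _ -> \bar R} :=
  product_measure1 (@lebesgue_measure R) mB.
pose S : set (measurableTypeR R * borelRn R n) := setT `*` slab i.
have mS : measurable S by apply: measurableX => //; exact: measurable_slab.
have -> : \int[lebesgue_measure]_t face_integral g i b t =
    \int[P]_(z in S) g (face_map i b z).
  under eq_integral do rewrite face_integralE//.
  rewrite -(fubini_tonelli1 (face_fun g i b) (@measurable_face_fun g i b mg)
    (@face_fun_ge0 g i b g0)).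
  rewrite [RHS]integral_mkcond; apply: eq_integral => z _.
  rewrite /face_fun patchE indicE /S in_setX in_setT /=.
  by case: ifPn => _; rewrite ?mule1 ?mule0.
apply: (@ge0_integral_le_boxes _ _ _ _ P S (face_map i b)) => // p.
pose T : set R := if b then `[(- p.2 ord0 i)%R, (- p.1 ord0 i)%R[%classic
  else `]p.1 ord0 i, p.2 ord0 i]%classic.
have mT : measurable T by rewrite /T; case: (b); exact: measurable_itv.
pose q := (upd p.1 i (-1)%R, upd p.2 i 1%R).
have -> : face_map i b @^-1` box p `&` S = T `*` box q.
  apply/seteqP; split=> [[t u] [/= H [_ su]]|[t u] [/= Tt H]].
    split.
      have := H i; rewrite mxE eqxx /= /T.
      case: (b) => /=; rewrite in_itv/= ?expr1 ?expr0 ?mulN1r ?mul1r//.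
      by move=> /andP[? ?]; apply/andP; split; lra.
    move=> j; have := H j; rewrite !mxE; case: eqP => [->//|//].
  split; last first.
    by split=> //; have := H i; rewrite /slab /= !mxE eqxx.
  move=> j; have := H j; rewrite !mxE; case: eqP => [-> _|//].
  move: Tt; rewrite /T; case: (b); rewrite /= in_itv/= ?expr1 ?expr0 ?mulN1r ?mul1r//.
  by move=> /andP[? ?]; apply/andP; split; lra.
rewrite /P /= product_measure1E//; last exact: measurable_box.
rewrite [X in X * _](_ : _ = (Num.max 0 (p.2 ord0 i - p.1 ord0 i))%:E); last first.
  change (lebesgue_measure T = (Num.max 0 (p.2 ord0 i - p.1 ord0 i))%:E).
  rewrite /T; case: (b); rewrite ?lebesgue_measure_ocitv// lebesgue_measure_coitv.
  by rewrite opprK addrC.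
apply: (le_trans (lee_wpmul2l _ (borel_measure_box_le _))).
  by rewrite lee_fin le_max lexx.
rewrite -EFinM lee_fin (box_volumeM q i) (box_volumeM p i) mulrCA ler_pM//.
- by rewrite le_max lexx.
- by rewrite mulr_ge0 ?le_max ?lexx// prodr_ge0// => j _; rewrite le_max lexx.
- by rewrite /q /= !mxE eqxx ge_max; apply/andP; split; lra.
- rewrite ler_wpM2l ?le_max ?lexx//; rewrite le_eqVlt; apply/orP; left; apply/eqP/eq_bigr => j ji.
  by rewrite /q /= !mxE (negbTE ji).
Qed.

End change_of_variables.

(** * Segments in the faces of a cube *)

Section weight.
Context {R : realType}.
Local Open Scope ereal_scope.

(** The power of [s] for which [weight n s ^+ n] cancels the Jacobian of a
    contraction by [s] in dimension [n - 1], while its integral near 0 is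
    finite. *)
Definition weight (n : nat) (s : R) : R := s `^ (n%:R^-1 - 1).

Lemma weight_gt0 n s : (0 < s)%R -> (0 < weight n s)%R.
Proof. by move=> s0; exact: powR_gt0. Qed.

Lemma weightX n s : (0 < n)%N -> (0 < s)%R -> (weight n s ^+ n = (s ^+ n.-1)^-1)%R.
Proof.
move=> n0 s0; rewrite -powR_mulrn ?powR_ge0// -powRrM mulrBl mul1r mulVf; last first.
  by rewrite pnatr_eq0 -lt0n.
rewrite -(powR_invn _ (ltW s0)); congr powR.
by rewrite -[in LHS](prednK n0) -natr1; lra.
Qed.

Lemma measurable_weight n : measurable_fun setT (weight n).
Proof. exact: measurable_powR. Qed.

(** The primitive [n s^(1/n)] has no derivative at 0, so the integral is computed
    on [1/(k+2), 1] and [k] tends to infinity. *)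
Lemma integral_weight_le (n : nat) : (0 < n)%N ->
  \int[lebesgue_measure]_(s in `]0%R, 1%R]) (weight n s)%:E <= n%:R%:E.
Proof.
move=> n0.
have nR0 : (0 < n%:R :> R)%R by rewrite ltr0n.
pose F (k : nat) : set R := `[(k.+2%:R^-1)%R, 1%R]%classic.
have FE : `]0%R, 1%R]%classic = \bigcup_k F k.
  apply/seteqP; split=> [s /=|s [k _]]; rewrite /F /= !in_itv/=.
    move=> /andP[s0 s1]; exists (Num.truncn s^-1) => //.
    rewrite /F /= in_itv/= s1 andbT -[leRHS]invrK lef_pV2 ?posrE ?invr_gt0//.
    apply: ltW; apply: lt_trans (truncnS_gt _) _.
    by rewrite ltr_nat.
  move=> /andP[ks ->]; rewrite andbT; apply: lt_le_trans ks.
  by rewrite invr_gt0.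
have mw D : measurable_fun D (fun s => (weight n s)%:E).
  by apply/measurable_EFinP/measurable_funTS; exact: measurable_weight.
have cvgF : \int[lebesgue_measure]_(s in F k) (weight n s)%:E @[k --> \oo] -->
    \int[lebesgue_measure]_(s in \bigcup_k F k) (weight n s)%:E.
  apply: ge0_nondecreasing_set_cvg_integral => //.
  - move=> k l kl; apply/subsetPset => s; rewrite /F /= !in_itv/= => /andP[ks s1].
    apply/andP; split=> //; apply: le_trans ks; rewrite lef_pV2 ?posrE//.
    by rewrite ler_nat !ltnS.
  - by move=> k; exact: measurable_itv.
  - by move=> k; exact: mw.
  - by move=> k s _; rewrite lee_fin powR_ge0.
rewrite FE; apply: (cvge_to_le cvgF).
apply: nearW => k.
have a0 : (0 < k.+2%:R^-1 :> R)%R by rewrite invr_gt0.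
have a1 : (k.+2%:R^-1 < 1 :> R)%R by rewrite invf_lt1// ltr1n.
pose G := (n%:R \*: ((fun s : R => s `^ n%:R^-1) : R -> R^o))%R : R -> R.
have posa (s : R) : s \in `[(k.+2%:R^-1)%R, 1%R] -> s \in `]0%R, +oo[.
  by rewrite !in_itv/= andbT => /andP[+ _]; exact: lt_le_trans.
have derF (s : R) : (0 < s)%R -> derivable G s 1.
  by move=> s0; apply: derivableZ; apply: derivable_powR; rewrite in_itv/= s0.
rewrite /F (@continuous_FTC2 _ _ G)//.
- rewrite /G /= powR1 /GRing.scale /= mulr1 -EFinB lee_fin gerBl.
  by rewrite mulr_ge0 ?powR_ge0// ltW.
- by apply: derivable_within_continuous => s /posa s0; exact: derivable_powR.
- split.
  + move=> s; rewrite in_itv/= => /andP[ks _].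
    exact/derF/(lt_trans a0).
  + exact/cvg_at_right_filter/differentiable_continuous/derivable1_diffP/derF.
  + exact/cvg_at_left_filter/differentiable_continuous/derivable1_diffP/derF.
- move=> s; rewrite in_itv/= => /andP[ks _].
  have s0 : (0 < s)%R by exact: lt_trans ks.
  rewrite derive1E deriveZ/=; last by apply: derivable_powR; rewrite in_itv/= s0.
  rewrite -derive1E powR_derive1 ?in_itv/= ?s0// /weight /GRing.scale /= mulrA divff ?mul1r//.
  by rewrite gt_eqF.
Qed.

End weight.

Section segments.
Context {R : realType} {n : nat}.
Hypothesis n0 : (0 < n)%N.
Local Open Scope ereal_scope.
Local Notation mB := (@borel_measureRn R n).
Implicit Types (u x : 'rV[R]_n) (g h : 'rV[R]_n -> \bar R).

(** A point [u] of the cube determines a segment in a face. With [J] full it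
    joins a fixed point [c] of the face to the projection of [u]; with [J] a
    single axis and [c] equal to 1 or -1 there, it joins the projection of [u]
    to an edge. *)
Definition face_segment (i : 'I_n) (b : bool) (J : pred 'I_n) (c : 'rV[R]_n)
    (s : R) (u : 'rV[R]_n) : 'rV[R]_n :=
  \row_j (if j == i then (-1) ^+ b
          else if J j then (1 - s) * c ord0 j + s * u ord0 j
          else u ord0 j)%R.

(** For a fixed [s] the points of the segments are an affine image of the cube,
    contracted by [t * s] or by [t] along each axis of the face. *)
Lemma integral_face_segment_le g i b J c (t s : R) :
  (forall x, 0 <= g x) -> measurable_fun setT (g : borelRn R n -> \bar R) ->
  (0 < t)%R -> (0 < s <= 1)%R ->
  \int[mB]_(u in cube 1) g (t *: face_segment i b J c s u) <=
  (((t * s) ^+ n.-1)^-1)%:E * face_integral g i b t.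
Proof.
move=> g0 mg t0 /andP[s0 s1].
pose h u := g (upd u i ((-1) ^+ b * t)%R) * (\1_(slab i) u)%:E.
have mupd a : measurable_fun setT (fun u : borelRn R n => upd u i a : borelRn R n).
  apply: measurable_fun_rV => j.
  rewrite (_ : (fun _ => _) = (fun u : borelRn R n =>
     if j == i then a else u ord0 j)%R); last by apply/funext => z; rewrite mxE.
  by case: eqP => _; [exact: measurable_cst|exact: measurable_coord].
have h0 u : 0 <= h u by rewrite mule_ge0// lee_fin indicE; case: (_ \in _).
have mh : measurable_fun setT (h : borelRn R n -> \bar R).
  apply: emeasurable_funM; first exact: (measurableT_comp mg (mupd _)).
  by apply/measurable_EFinP/measurable_indic; exact: measurable_slab.
have hE : face_integral g i b t = \int[mB]_u h (u : borelRn R n).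
  rewrite /face_integral integral_mkcond; apply: eq_integral => u _.
  by rewrite /h /= patchE indicE; case: ifPn => _; rewrite ?mule1 ?mule0.
pose a j : R := (if (j == i) || ~~ J j then 0 else t * ((1 - s) * c ord0 j))%R.
pose k j : R := (if j == i then 1 else if J j then t * s else t)%R.
have k0 j : (0 < k j)%R by rewrite /k; case: ifP => // _; case: ifP => // _; rewrite mulr_gt0.
rewrite (eq_integral (fun u : borelRn R n => h (\row_j (a j + k j * u ord0 j))%R)); last first.
  move=> u /set_mem /cubeP Qu; rewrite /h indicE mem_set ?mule1; last first.
    by rewrite /slab /= mxE /a /k eqxx /= add0r mul1r; exact: Qu.
  congr g; apply/rowP => j; rewrite !mxE /a /k; case: eqP => _ /=.
    by rewrite mulrC.
  by case: (J j) => /=; ring.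
apply: le_trans (ge0_integral_affine _ (@measurable_cube _ _ _) k0 h0 mh) _.
rewrite hE lee_wpmul2r ?integral_ge0// lee_fin lef_pV2 ?posrE; last 2 first.
- by apply: prodr_gt0 => j _.
- by rewrite exprn_gt0// mulr_gt0.
rewrite (bigD1 i)//= {1}/k eqxx mul1r.
rewrite (_ : n.-1 = #|[pred j : 'I_n | j != i]|); last first.
  by rewrite cardC1 card_ord.
rewrite -prodr_const; apply: ler_prod => j /= ji; apply/andP; split; first by rewrite mulr_ge0 ?ltW.
rewrite /k (negbTE ji); case: (J j) => //.
by rewrite ler_piMr// ltW.
Qed.

End segments.

Section fubini_on_sets.
Context d1 d2 (T1 : measurableType d1) (T2 : measurableType d2) (R : realType).
Variables (m1 : {sigma_finite_measure set T1 -> \bar R}).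
Variables (m2 : {sigma_finite_measure set T2 -> \bar R}).
Variables (A : set T1) (B : set T2) (F : T1 * T2 -> \bar R).
Hypotheses (mA : measurable A) (mB : measurable B).
Hypotheses (F0 : forall z, (0 <= F z)%E) (mF : measurable_fun setT F).
Local Open Scope ereal_scope.

Let integral_indicE d (T : measurableType d) (m : {measure set T -> \bar R})
  (D : set T) (f : T -> \bar R) :
  \int[m]_(x in D) f x = \int[m]_x (f x * (\1_D x)%:E).
Proof.
rewrite integral_mkcond; apply: eq_integral => x _.
by rewrite patchE indicE; case: ifPn => _; rewrite ?mule1 ?mule0.
Qed.

Lemma measurable_fun_integral_fst :
  measurable_fun setT (fun y => \int[m1]_(x in A) F (x, y)).
Proof.
under eq_fun do rewrite integral_indicE.
apply: (@measurable_fun_fubini_tonelli_G _ _ T1 T2 R m1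
  (fun z => F z * (\1_A z.1)%:E)).
- apply: emeasurable_funM => //; apply/measurable_EFinP; apply: measurableT_comp => //.
- by move=> z; rewrite mule_ge0// lee_fin indicE; case: (_ \in _).
Qed.

Lemma measurable_fun_integral_snd :
  measurable_fun setT (fun x => \int[m2]_(y in B) F (x, y)).
Proof.
under eq_fun do rewrite integral_indicE.
apply: (@measurable_fun_fubini_tonelli_F _ _ T1 T2 R m2
  (fun z => F z * (\1_B z.2)%:E)).
- apply: emeasurable_funM => //; apply/measurable_EFinP; apply: measurableT_comp => //.
- by move=> z; rewrite mule_ge0// lee_fin indicE; case: (_ \in _).
Qed.

Lemma fubini_tonelli_set :
  \int[m2]_(y in B) \int[m1]_(x in A) F (x, y) =
  \int[m1]_(x in A) \int[m2]_(y in B) F (x, y).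
Proof.
pose F' z := F z * ((\1_A z.1)%:E * (\1_B z.2)%:E).
have i0 d (T : measurableType d) (D : set T) x : 0 <= (\1_D x : R)%:E.
  by rewrite lee_fin indicE; case: (_ \in _).
have mi d (T : measurableType d) (D : set T) : measurable D ->
    measurable_fun setT (fun x => (\1_D x : R)%:E).
  by move=> mD; exact/measurable_EFinP.
have F'0 z : 0 <= F' z by rewrite /F' !mule_ge0.
have mF' : measurable_fun setT F'.
  apply: emeasurable_funM => //; apply: emeasurable_funM.
    exact: (measurableT_comp (mi _ _ _ mA)).
  exact: (measurableT_comp (mi _ _ _ mB)).
rewrite [RHS]integral_indicE [LHS]integral_indicE.
transitivity (\int[m2]_y \int[m1]_x F' (x, y)).
  apply: eq_integral => y _.
  rewrite [X in X * _]integral_indicE -ge0_integralZr//; last 2 first.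
  - apply: (@emeasurable_funM _ _ _ _ (fun x => F (x, y))); last exact: mi.
    by apply: measurableT_comp.
  - by move=> x _; rewrite mule_ge0.
  by apply: eq_integral => x _; rewrite /F' /= muleA.
rewrite -(fubini_tonelli F')//; apply: eq_integral => x _.
rewrite [X in _ = X * _]integral_indicE -ge0_integralZr//; last 2 first.
- apply: (@emeasurable_funM _ _ _ _ (fun y => F (x, y))); last exact: mi.
  by apply: measurableT_comp.
- by move=> y _; rewrite mule_ge0.
by apply: eq_integral => y _; rewrite /F' /= -!muleA; congr (_ * _); rewrite muleC.
Qed.

End fubini_on_sets.

Section segment_cost.
Context {R : realType} {n : nat}.
Hypothesis n0 : (0 < n)%N.
Local Open Scope ereal_scope.
Local Notation mB := (@borel_measureRn R n).
Implicit Types (u x c : 'rV[R]_n) (g : 'rV[R]_n -> \bar R) (J : pred 'I_n).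

(** By Young's inequality [young_cost d g] bounds every [rho] whose [n]-th power
    is bounded by [g], whatever the threshold [d]. *)
Definition young_cost (d : R) (y : \bar R) : \bar R := d%:E + (d ^- n.-1)%:E * y.

Lemma le_young_cost (d : R) (r y : \bar R) :
  (0 < d)%R -> 0 <= r -> r ^+ n <= y -> r <= young_cost d y.
Proof.
move=> d0 r0 rny; apply: (@le_trans _ _ (young_cost d (r ^+ n))); last first.
  by rewrite leeD2l// lee_wpmul2l// lee_fin invr_ge0 exprn_ge0// ltW.
have rn0 : 0 <= r ^+ n by exact: expe_ge0.
have dn0 : (0 < d ^- n.-1)%R by rewrite invr_gt0 exprn_gt0.
have [rd|dr] := leP r d%:E.
  by apply: (le_trans rd); rewrite /young_cost leeDl// mule_ge0// lee_fin ltW.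
rewrite /young_cost; move: r r0 {rny} rn0 dr => [r||]//=; last first.
  by move=> _ _ _; rewrite -(prednK n0) expeS gt0_mulye ?expe_gt0// gt0_muley ?lte_fin// addey.
rewrite !lee_fin lte_fin -EFin_expe => r0 _ dr.
rewrite -EFinM -EFinD lee_fin -[in leRHS](prednK n0) exprS.
apply: (@le_trans _ _ (d ^- n.-1 * (r * r ^+ n.-1))%R); last by rewrite lerDr ltW.
rewrite mulrCA ler_peMr// mulrC ler_pdivlMr ?exprn_gt0// mul1r.
by rewrite lerXn2r// ?nnegrE ltW// (lt_trans d0).
Qed.

Lemma young_cost_ge0 (d : R) y : (0 <= d)%R -> 0 <= y -> 0 <= young_cost d y.
Proof.
move=> d0 y0; apply: adde_ge0; first by rewrite lee_fin.
by apply: mule_ge0 => //; rewrite lee_fin invr_ge0 exprn_ge0.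
Qed.

Lemma measurable_young_cost d (T : measurableType d) (w : T -> R) (h : T -> \bar R) :
  (forall z, 0 <= w z)%R -> measurable_fun setT w -> measurable_fun setT h ->
  measurable_fun setT (fun z => young_cost (w z) (h z)).
Proof.
move=> w0 mw mh; apply: emeasurable_funD; first exact/measurable_EFinP.
apply: emeasurable_funM => //; apply/measurable_EFinP.
rewrite (_ : (fun _ => _) = (fun z => (w z ^+ n.-1) `^ (-1))%R); last first.
  by apply/funext => z; rewrite powR_inv1// exprn_ge0.
apply: (@measurableT_comp _ _ _ _ _ _ (fun y : R => y `^ (-1))%R) => //.
exact: measurable_funX.
Qed.

Definition segment_cost g (i : 'I_n) (b : bool) J c (k t : R) u : \bar R :=
  \int[lebesgue_measure]_(s in `]0%R, 1%R])
    young_cost (k / t * weight n s) (g (t *: face_segment i b J c s u)).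

Let cost_fun g i b J c (k t : R) (z : measurableTypeR R * borelRn R n) :=
  young_cost (k / t * weight n z.1) (g (t *: face_segment i b J c z.1 z.2)).

Lemma measurable_face_segment i b J c (t : R) :
  measurable_fun setT (fun z : measurableTypeR R * borelRn R n =>
     t *: face_segment i b J c z.1 z.2 : borelRn R n)%R.
Proof.
have msnd j : measurable_fun setT
    (fun z : measurableTypeR R * borelRn R n => z.2 ord0 j : R).
  by apply: (@measurableT_comp _ _ _ _ _ _ (fun u : borelRn R n => u ord0 j : R)) => //;
    exact: measurable_coord.
have mfst : measurable_fun setT (fun z : measurableTypeR R * borelRn R n => z.1 : R).
  exact: measurable_fst.
apply: measurable_fun_rV => j.
rewrite (_ : (fun _ => _) = (fun z : measurableTypeR R * borelRn R n =>
    t * if j == i then (-1) ^+ b else if J j then (1 - z.1) * c ord0 j + z.1 * z.2 ord0 j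
                  else z.2 ord0 j)%R); last first.
  by apply/funext => z; rewrite !mxE.
apply: measurable_funM => //; case: (j == i) => //; case: (J j) => //.
apply: measurable_funD; apply: measurable_funM => //.
exact: measurable_funB.
Qed.

Let measurable_cost_fun g i b J c k t :
  measurable_fun setT (g : borelRn R n -> \bar R) -> (0 < k)%R -> (0 < t)%R ->
  measurable_fun setT (cost_fun g i b J c k t).
Proof.
move=> mg k0 t0.
apply: measurable_young_cost.
- by move=> z; rewrite mulr_ge0 ?powR_ge0// divr_ge0// ltW.
- apply: measurable_funM => //.
  by apply: (measurableT_comp (measurable_weight n)); exact: measurable_fst.
- exact: (measurableT_comp mg (measurable_face_segment i b J c t)).
Qed.

Let cost_fun_ge0 g i b J c k t : (forall x, 0 <= g x) -> (0 < k)%R -> (0 < t)%R ->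
  forall z, 0 <= cost_fun g i b J c k t z.
Proof.
move=> g0 k0 t0 z; apply: young_cost_ge0 => //.
by rewrite mulr_ge0 ?powR_ge0// divr_ge0// ltW.
Qed.

Lemma segment_cost_ge0 g i b J c k t u : (forall x, 0 <= g x) -> (0 < k)%R ->
  (0 < t)%R -> 0 <= segment_cost g i b J c k t u.
Proof.
by move=> g0 k0 t0; apply: integral_ge0 => s _;
  exact: (@cost_fun_ge0 g i b J c k t g0 k0 t0 (s, u)).
Qed.

Lemma measurable_segment_cost g i b J c k t : (forall x, 0 <= g x) ->
  measurable_fun setT (g : borelRn R n -> \bar R) -> (0 < k)%R -> (0 < t)%R ->
  measurable_fun setT (segment_cost g i b J c k t : borelRn R n -> \bar R).
Proof.
move=> g0 mg k0 t0; apply: (@measurable_fun_integral_fst _ _ (measurableTypeR R)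
  (borelRn R n) R lebesgue_measure `]0%R, 1%R]%classic (cost_fun g i b J c k t)) => //.
- exact: cost_fun_ge0.
- exact: measurable_cost_fun.
Qed.

(** By the choice of [weight] the two terms of Young's inequality, integrated
    over the cube for a fixed [s], are both multiples of [weight n s]. *)
Lemma integral_segment_cost_le g i b J c k t : (forall x, 0 <= g x) ->
  measurable_fun setT (g : borelRn R n -> \bar R) -> (0 < k)%R -> (0 < t)%R ->
  \int[mB]_(u in cube 1) segment_cost g i b J c k t u <=
  (k / t * n%:R)%:E * mB (cube 1) + (n%:R * k ^- n.-1)%:E * face_integral g i b t.
Proof.
move=> g0 mg k0 t0.
rewrite (@fubini_tonelli_set _ _ (measurableTypeR R) (borelRn R n) R lebesgue_measure mB
  `]0%R, 1%R]%classic (cube 1) (cost_fun g i b J c k t)) //; last 3 first.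
- exact: measurable_cube.
- exact: cost_fun_ge0.
- exact: measurable_cost_fun.
have G0 := face_integral_ge0 i b t g0.
have mw (a : R) : measurable_fun setT (fun s => (a * weight n s)%:E).
  by apply/measurable_EFinP; apply: measurable_funM => //; exact: measurable_weight.
apply: (@le_trans _ _ (\int[lebesgue_measure]_(s in `]0%R, 1%R])
   ((weight n s)%:E * ((k / t)%:E * mB (cube 1) + (k ^- n.-1)%:E * face_integral g i b t)))).
  apply: ge0_le_integral => //.
  - by move=> s _; apply: integral_ge0 => u _;
      exact: (@cost_fun_ge0 g i b J c k t g0 k0 t0 (s, u)).
  - apply: measurable_funTS; apply: (@measurable_fun_integral_snd _ _ (measurableTypeR R)
      (borelRn R n) R mB (cube 1) (cost_fun g i b J c k t)).
    + exact: measurable_cube.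
    + exact: cost_fun_ge0.
    + exact: measurable_cost_fun.
  - apply: measurable_funTS; apply: emeasurable_funM => //.
    by apply/measurable_EFinP; exact: measurable_weight.
  move=> s; rewrite /= in_itv/= => /andP[s0 s1].
  have w0 := weight_gt0 n s0.
  have d0 : (0 < k / t * weight n s)%R by rewrite mulr_gt0// divr_gt0.
  have dn0 : (0 <= (k / t * weight n s) ^- n.-1)%R by rewrite invr_ge0 exprn_ge0// ltW.
  have mgs : measurable_fun (cube 1) (fun u : borelRn R n =>
      g (t *: face_segment i b J c s u)).
    apply: measurable_funTS.
    by apply: (measurableT_comp (measurableT_comp mg (measurable_face_segment i b J c t))
         (pair1_measurable (s : measurableTypeR R))).
  rewrite /cost_fun /young_cost /= ge0_integralD//; last 4 first.
  - exact: measurable_cube.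
  - by move=> u _; rewrite lee_fin ltW.
  - by move=> u _; apply: mule_ge0; rewrite ?lee_fin.
  - exact: measurable_funeM.
  rewrite integral_cst; last exact: measurable_cube.
  rewrite ge0_integralZl//; last exact: measurable_cube.
  rewrite [leRHS]ge0_muleDr//; last 2 first.
  - by rewrite mule_ge0// lee_fin divr_ge0// ltW.
  - by rewrite mule_ge0// lee_fin invr_ge0 exprn_ge0// ltW.
  apply: leeD; first by rewrite muleA -EFinM mulrC.
  apply: (@le_trans _ _ (((k / t * weight n s) ^- n.-1)%:E *
     ((((t * s) ^+ n.-1)^-1)%:E * face_integral g i b t))).
    apply: lee_wpmul2l; first by rewrite lee_fin.
    by apply: integral_face_segment_le => //; rewrite s0 s1.
  rewrite !muleA -!EFinM lee_wpmul2r// lee_fin le_eqVlt; apply/orP; left; apply/eqP.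
  rewrite !exprMn exprVn.
  have : (weight n s * weight n s ^+ n.-1 = (s ^+ n.-1)^-1)%R.
    by rewrite -exprS prednK// weightX.
  have := exprn_gt0 n.-1 s0; have := exprn_gt0 n.-1 w0.
  have := exprn_gt0 n.-1 t0; have := exprn_gt0 n.-1 k0.
  set K := (k ^+ _)%R; set T := (t ^+ _)%R; set W := (weight n s ^+ _)%R; set S := (s ^+ _)%R.
  move=> K0 T0 W0 S0 wW.
  have -> : weight n s = (W^-1 * S^-1)%R by rewrite -wW; field; rewrite gt_eqF.
  field; rewrite !gt_eqF//.
rewrite ge0_integralZr//=; last 3 first.
- by apply/measurable_EFinP/measurable_funTS; exact: measurable_weight.
- by move=> s _; rewrite lee_fin powR_ge0.
- by rewrite adde_ge0// mule_ge0// lee_fin ?invr_ge0 ?exprn_ge0 ?divr_ge0// ltW.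
apply: (le_trans (lee_wpmul2r _ (integral_weight_le n0))).
  by rewrite adde_ge0// mule_ge0// lee_fin ?invr_ge0 ?exprn_ge0 ?divr_ge0// ltW.
rewrite [leLHS]ge0_muleDr//; last 2 first.
- by rewrite mule_ge0// lee_fin divr_ge0// ltW.
- by rewrite mule_ge0// lee_fin invr_ge0 exprn_ge0// ltW.
by rewrite !muleA -!EFinM [(n%:R * (k / t))%R]mulrC.
Qed.

End segment_cost.

(** * Euclidean norm and straight lines *)

Section euclidean_norm.
Context {R : realType} {n : nat}.
Implicit Types (x y : 'rV[R]_n).

Lemma enorm_ge0 x : 0 <= enorm x.
Proof. exact: sqrtr_ge0. Qed.

Lemma enorm_sqr x : enorm x ^+ 2 = \sum_i x ord0 i ^+ 2.
Proof. by rewrite sqr_sqrtr// sumr_ge0// => i _; exact: sqr_ge0. Qed.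

Lemma enormZ (k : R) x : enorm (k *: x) = `|k| * enorm x.
Proof.
rewrite /enorm (eq_bigr (fun i => k ^+ 2 * x ord0 i ^+ 2)); last first.
  by move=> i _; rewrite mxE exprMn.
by rewrite -mulr_sumr sqrtrM ?sqr_ge0// sqrtr_sqr.
Qed.

Lemma enormN x : enorm (- x) = enorm x.
Proof. by rewrite -scaleN1r enormZ normrN1 mul1r. Qed.

Lemma enorm0 : enorm (0 : 'rV[R]_n) = 0.
Proof. by rewrite -(scale0r 0) enormZ normr0 mul0r. Qed.

Lemma enorm_eq0 x : enorm x = 0 -> x = 0.
Proof.
move=> x0; have := enorm_sqr x; rewrite x0 expr0n /= => /esym/eqP.
rewrite psumr_eq0; last by move=> i _; exact: sqr_ge0.
move=> /allP x2; apply/rowP => i; rewrite mxE; apply/eqP.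
by have := x2 i (mem_index_enum i); rewrite sqrf_eq0.
Qed.

Lemma enorm_gt0 x : x != 0 -> 0 < enorm x.
Proof.
move=> x0; rewrite lt_neqAle enorm_ge0 andbT eq_sym.
by apply: contra x0 => /eqP/enorm_eq0 ->.
Qed.

Let cauchy_schwarz x y : \sum_i x ord0 i * y ord0 i <= enorm x * enorm y.
Proof.
have [->|x0] := eqVneq x 0.
  rewrite enorm0 mul0r big1// => i _; by rewrite mxE mul0r.
have [->|y0] := eqVneq y 0.
  rewrite enorm0 mulr0 big1// => i _; by rewrite mxE mulr0.
have a0 := enorm_gt0 x0; have b0 := enorm_gt0 y0.
set a := enorm x in a0 *; set b := enorm y in b0 *.
have : 0 <= \sum_i (b * x ord0 i - a * y ord0 i) ^+ 2.
  by apply: sumr_ge0 => i _; exact: sqr_ge0.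
rewrite (eq_bigr (fun i => b ^+ 2 * x ord0 i ^+ 2 + a ^+ 2 * y ord0 i ^+ 2
  - 2 * a * b * (x ord0 i * y ord0 i))); last by move=> i _; ring.
rewrite sumrB big_split/= -!mulr_sumr -!enorm_sqr -/a -/b.
have -> : b ^+ 2 * a ^+ 2 + a ^+ 2 * b ^+ 2 - 2 * a * b * \sum_i x ord0 i * y ord0 i =
  (2 * a * b) * (a * b - \sum_i x ord0 i * y ord0 i) by ring.
by rewrite pmulr_rge0 ?subr_ge0// !mulr_gt0.
Qed.

Lemma enormD x y : enorm (x + y) <= enorm x + enorm y.
Proof.
rewrite -(@ler_pXn2r _ 2)// ?nnegrE ?addr_ge0 ?enorm_ge0// sqrrD !enorm_sqr.
rewrite (eq_bigr (fun i => x ord0 i ^+ 2 + (x ord0 i * y ord0 i) *+ 2 + y ord0 i ^+ 2)); last first.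
  by move=> i _; rewrite mxE sqrrD.
rewrite big_split/= [X in X + _]big_split/= sumrMnl lerD2r lerD2l lerMn2r/=.
exact: cauchy_schwarz.
Qed.

Lemma enorm_distrC x y : enorm (x - y) = enorm (y - x).
Proof. by rewrite -enormN opprB. Qed.

Lemma enorm_dist_le x y z : `|enorm (x - z) - enorm (y - z)| <= enorm (x - y).
Proof.
rewrite ler_norml; apply/andP; split.
  by have := enormD (y - x) (x - z); rewrite subrKA (enorm_distrC y x); lra.
by have := enormD (x - y) (y - z); rewrite subrKA; lra.
Qed.

Lemma coord_le_norm x i : `|x ord0 i| <= `|x|.
Proof.
by rewrite [leRHS]/Num.norm/= mx_normrE; apply/bigmax_geP; right; exists (ord0, i).
Qed.

Lemma coord_le_enorm x i : `|x ord0 i| <= enorm x.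
Proof.
rewrite -sqrtr_sqr ler_sqrt ?sumr_ge0// => [|j _]; last exact: sqr_ge0.
by rewrite (bigD1 i)//= lerDl sumr_ge0// => j _; exact: sqr_ge0.
Qed.

Lemma norm_le_enorm x : `|x| <= enorm x.
Proof.
rewrite [leLHS]/Num.norm/= mx_normrE; apply: bigmax_le => [|[i j] _].
  exact: enorm_ge0.
by rewrite (ord1 i); exact: coord_le_enorm.
Qed.

Lemma enorm_le_norm x : enorm x <= n%:R * `|x|.
Proof.
rewrite -(@ler_pXn2r _ 2)// ?nnegrE ?enorm_ge0 ?mulr_ge0// enorm_sqr exprMn.
apply: (@le_trans _ _ (\sum_(i < n) `|x| ^+ 2)).
  apply: ler_sum => i _; rewrite -[leLHS]real_normK ?num_real//.
  by rewrite lerXn2r ?nnegrE// coord_le_norm.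
rewrite sumr_const card_ord -[leLHS]mulr_natl ler_wpM2r ?sqr_ge0//.
by rewrite -natrX ler_nat; case: (n) => // k; rewrite leq_pmulr.
Qed.

Lemma continuous_enorm : continuous (@enorm R n).
Proof.
move=> x; apply/(@cvgrPdist_lt _ _ _ _ (nbhs_filter x)) => e e0; near=> y.
apply: (@le_lt_trans _ _ (n%:R * `|x - y|)).
  by apply: le_trans (enorm_le_norm _); have := enorm_dist_le x y 0; rewrite !subr0.
apply: (@le_lt_trans _ _ (n.+1%:R * `|x - y|)); first by rewrite ler_wpM2r// ler_nat.
rewrite mulrC -ltr_pdivlMr//; near: y.
by apply: cvgr_dist_lt => //; rewrite divr_gt0.
Unshelve. all: by end_near. Qed.

End euclidean_norm.

Section affine_line.
Context {R : realType}.
Local Open Scope ereal_scope.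

Lemma ge0_integral_affine_line (a b : R) (S : set R) (h : R -> \bar R) :
  measurable S -> (b != 0)%R -> (forall x, 0 <= h x) -> measurable_fun setT h ->
  \int[lebesgue_measure]_(s in S) h (a + b * s)%R <=
  (`|b|^-1)%:E * \int[lebesgue_measure]_x h x.
Proof.
move=> mS b0 h0 mh.
pose phi (s : measurableTypeR R) : measurableTypeR R := (a + b * s)%R.
have mphi : measurable_fun setT phi by apply: measurable_funD => //; exact: measurable_funM.
pose nu : {measure set (measurableTypeR R) -> \bar R} :=
  measure_function_pushforward__canonical__measure_function_Measure
    (@lebesgue_measure R) mphi.
pose k : {nonneg R} := NngNum (normr_ge0 b).
pose mu' : {measure set (measurableTypeR R) -> \bar R} := mscale k nu.
have muE : forall A, measurable A -> lebesgue_measure A = mu' A.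
  apply: lebesgue_measure_unique => _ [[x y] _ <-] /=.
  rewrite /mu' /= /mscale /= /nu /= /pushforward.
  rewrite [LHS](_ : _ = (Num.max 0 (y - x))%:E); last exact: lebesgue_measure_ocitv.
  have [b1|b1] := ltP 0%R b.
    rewrite (_ : phi @^-1` _ = `](x - a) / b, (y - a) / b]%classic)%R; last first.
      apply/seteqP; split=> s /=; rewrite !in_itv/= /phi ltr_pdivrMr// ler_pdivlMr// => /andP[? ?];
      by apply/andP; split; lra.
    rewrite [X in _ * X](_ : _ = (Num.max 0 ((y - a) / b - (x - a) / b))%:E); last first.
      exact: lebesgue_measure_ocitv.
    rewrite -EFinM maxr_pMr// mulr0 -mulrBl gtr0_norm// mulrC mulfVK//.
    by congr (Num.max _ _)%:E; ring.
  have {}b1 : (b < 0)%R by rewrite lt_neqAle b0.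
  rewrite (_ : phi @^-1` _ = `[(y - a) / b, (x - a) / b[%classic)%R; last first.
    apply/seteqP; split=> s /=; rewrite !in_itv/= /phi ltr_ndivlMr// ler_ndivrMr// => /andP[? ?];
    by apply/andP; split; lra.
  rewrite [X in _ * X](_ : _ = (Num.max 0 ((x - a) / b - (y - a) / b))%:E); last first.
    exact: lebesgue_measure_coitv.
  rewrite -EFinM maxr_pMr// mulr0 -mulrBl ltr0_norm// mulNr mulrC mulfVK//.
  by congr (Num.max _ _)%:E; ring.
have mhphi : measurable_fun setT (h \o phi) by exact: measurableT_comp.
apply: (@le_trans _ _ (\int[lebesgue_measure]_s h (phi s))).
  by apply: ge0_subset_integral => //=; exact: measurable_funTS.
have -> : \int[lebesgue_measure]_s h (phi s) = \int[nu]_x h x.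
  have := @ge0_integral_pushforward _ _ _ _ _ _ mphi (@lebesgue_measure R) setT h measurableT mh.
  by rewrite preimage_setT => -> // x _; exact: h0.
rewrite lee_pdivlMl ?normr_gt0//.
have -> : \int[lebesgue_measure]_x h x = \int[mu']_x h x.
  by apply: eq_measure_integral => A mA _; exact: muE.
by rewrite /mu' ge0_integral_mscale.
Qed.

End affine_line.

Section lines.
Context {R : realType} {n : nat}.
Implicit Types (a v : 'rV[R]_n).

Lemma continuous_line a v : continuous (fun t : R => a + t *: v).
Proof.
move=> t; apply: cvgD; first exact: cvg_cst.
by apply: cvgZr_tmp; exact: cvg_id.
Qed.

Lemma measurable_line a v :
  measurable_fun setT (fun t : measurableTypeR R => a + t *: v : borelRn R n).
Proof.
apply: measurable_fun_rV => i.
rewrite (_ : (fun _ => _) = (fun t => a ord0 i + t * v ord0 i)); last first.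
  by apply/funext => t; rewrite !mxE.
by apply: measurable_funD => //; exact: measurable_funM.
Qed.

End lines.

(** * Line integrals along segments *)

Section straight_paths.
Context {R : realType} {n : nat}.
Local Open Scope ereal_scope.
Variables (p v : 'rV[R]_n) (c d : R).
Hypotheses (v0 : v != 0%R) (cd : (c < d)%R).

Definition straight_path : ppath R 'rV[R]_n := PPath c d (fun t => p + t *: v)%R.

Let w0 : (0 < enorm v)%R. Proof. exact: enorm_gt0. Qed.

Lemma path_length_straight (a b : R) : (a <= b)%R ->
  path_length straight_path a b = ((b - a) * enorm v)%:E.
Proof.
move=> ab; rewrite /path_length.
have partE s : itv_partition a b s ->
    (\sum_(0 <= k < size s) enorm ((pfun straight_path \o nth b (a :: s)) k.+1 -
       (pfun straight_path \o nth b (a :: s)) k) = (b - a) * enorm v)%R.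
  move=> [/pathP apth /eqP alast].
  rewrite (eq_big_nat _ _ (F2 := fun k => (nth b (a :: s) k.+1 - nth b (a :: s) k) * enorm v)%R).
    rewrite -mulr_suml telescope_sumr//.
    by congr ((_ - _) * _)%R; rewrite -(last_nth b).
  move=> k /andP[_ ks]; rewrite /straight_path /= opprD addrACA subrr add0r -scalerBl.
  by rewrite enormZ gtr0_norm// subr_gt0 -[ltRHS]/(nth b s k); exact: apth.
have [s abs] : exists s, itv_partition a b s.
  move: ab; rewrite le_eqVlt => /orP[/eqP->|ab].
    by exists [::]; split => //=.
  by exists [:: b]; exact: itv_partition1.
rewrite (_ : [set _ | _ in _] = [set ((b - a) * enorm v)%:E]) ?ereal_sup1//.
apply/seteqP; split=> [_ [r /= rab <-]|_ ->]; first by rewrite partE.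
by exists s => //=; rewrite partE.
Qed.

Lemma locally_rectifiable_straight : locally_rectifiable straight_path.
Proof. by move=> a b _ ab _; rewrite path_length_straight// ltry. Qed.

Lemma normal_representation_straight (s : R) :
  (0 <= s <= (d - c) * enorm v)%R ->
  normal_representation straight_path s = (p + (c + s / enorm v) *: v)%R.
Proof.
move=> /andP[s0 s1]; rewrite /normal_representation /=; congr (p + _ *: v)%R.
apply: xget_subset1; last first.
  move=> t u /= [/andP[ct _] +] [/andP[cu _] +].
  rewrite !path_length_straight// => -[<-] -[] /(mulIf (lt0r_neq0 w0)) ut.
  by lra.
split; last first.
  rewrite path_length_straight ?lerDl ?divr_ge0 ?(ltW w0)//.
  by congr EFin; field; rewrite gt_eqF.
rewrite lerDl divr_ge0 ?(ltW w0)//= -lerBrDl.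
by rewrite ler_pdivrMr.
Qed.

Lemma line_integral_straight_le (rho : 'rV[R]_n -> \bar R) (D : set R) :
  measurable D -> `[c, d]%classic `<=` D ->
  (forall x, 0 <= rho x) -> measurable_fun setT (rho : borelRn R n -> \bar R) ->
  line_integral rho straight_path <=
  (enorm v)%:E * \int[lebesgue_measure]_(t in D) rho (p + t *: v)%R.
Proof.
move=> mD cdD rho0 mrho; rewrite /line_integral path_length_straight ?(ltW cd)//.
set S := `[0%R, _]%classic.
pose h t : \bar R := ((fun t => rho (p + t *: v)%R) \_ D) t.
have h0 t : 0 <= h t by apply: erestrict_ge0.
have mh : measurable_fun setT h.
  apply/(measurable_restrictT _ _).1 => //; apply: measurable_funTS.
  exact: (measurableT_comp mrho (measurable_line p v)).
rewrite [leLHS](_ : _ = \int[lebesgue_measure]_(s in S) h (c + (enorm v)^-1 * s)%R); last first.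
  apply: eq_integral => s sS.
  have /andP[s0 s1] : (0 <= s <= (d - c) * enorm v)%R.
    by move: sS; rewrite inE /S /= in_itv.
  rewrite normal_representation_straight ?s0// mulrC /h patchE mem_set//.
  apply: cdD; rewrite /= in_itv/= lerDl mulr_ge0 ?invr_ge0 ?(ltW w0)//=.
  by rewrite -lerBrDl mulrC ler_pdivrMr.
have vinv0 : ((enorm v)^-1 != 0)%R by rewrite invr_eq0 gt_eqF.
apply: le_trans (ge0_integral_affine_line c (measurable_itv _) vinv0 h0 mh) _.
by rewrite normfV invrK gtr0_norm// [in leRHS]integral_mkcond.
Qed.

End straight_paths.

Section crossing.
Context {R : realType}.
Implicit Types (h : R -> R) (a b r : R).

Let first_hit h a b r : a <= b -> (forall t, a <= t <= b -> {for t, continuous h}) ->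
  h a < r -> r <= h b -> exists d, [/\ a < d, d <= b, h d = r &
    forall t, a <= t < d -> h t < r].
Proof.
move=> ab hc ha hb.
pose S := [set t | a <= t <= b /\ r <= h t].
have Sb : S b by split=> //; rewrite ab lexx.
have lbS : lbound S a by move=> t [/andP[]].
have infS : has_inf S by split; [exists b|exists a].
have ad : a <= inf S by apply: lb_le_inf => //; exists b.
have db : inf S <= b by apply: ge_inf => //; exists a.
have cd := hc (inf S); rewrite ad db in cd; have {}cd := cd isT.
have ltS t : a <= t < inf S -> h t < r.
  move=> /andP[at' td]; rewrite ltNge; apply/negP => rht.
  have : inf S <= t.
    by apply: ge_inf; [exists a|split=> //; rewrite at' (le_trans (ltW td))].
  by rewrite leNgt td.
have rd : r <= h (inf S).
  rewrite leNgt; apply/negP => hdr.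
  have [e /= e0 he] : exists2 e : R, 0 < e & forall t, ball (inf S) e t -> h t < r.
    have : nbhs (inf S) [set t | h t < r] by exact: cvgr_lt cd _ hdr.
    by move=> /nbhs_ballP[e e0 he]; exists e.
  have [t [tab rt] te] := inf_adherent e0 infS.
  have dt : inf S <= t by apply: ge_inf => //; exists a.
  have : h t < r by apply: he; rewrite /ball/= distrC ger0_norm; lra.
  by rewrite ltNge rt.
have {}ad : a < inf S.
  rewrite lt_neqAle ad andbT; apply/eqP => aE.
  by move: rd; rewrite -aE leNgt ha.
exists (inf S); split => //; apply/eqP; rewrite eq_le rd andbT leNgt; apply/negP => hdr.
have [e /= e0 he] : exists2 e : R, 0 < e & forall t, ball (inf S) e t -> r < h t.
  have : nbhs (inf S) [set t | r < h t] by exact: cvgr_gt cd _ hdr.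
  by move=> /nbhs_ballP[e e0 he]; exists e.
pose t := Num.max a (inf S - e / 2).
have tS : t < inf S by rewrite gt_max ad /=; lra.
have : h t < r by apply: ltS; rewrite tS andbT le_max lexx.
rewrite ltNge => /negP; apply; apply/ltW/he; rewrite /ball/= gtr0_norm ?subr_gt0//.
have : inf S - e / 2 <= t by rewrite le_max lexx orbT.
lra.
Qed.

(** By reversal of both axes. *)
Let last_hit h a b r : a <= b -> (forall t, a <= t <= b -> {for t, continuous h}) ->
  h a <= r -> r < h b -> exists c, [/\ a <= c, c < b, h c = r &
    forall t, c < t <= b -> r < h t].
Proof.
move=> ab hc ha hb.
have [||||d [d1 d2 d3 d4]] := @first_hit (fun t => - h (- t)) (- b) (- a) (- r).
- by rewrite lerN2.
- move=> t /andP[t1 t2].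
  apply: continuousN; apply: (@continuous_comp _ _ _ -%R h).
    exact: opp_continuous.
  by apply: hc; apply/andP; split; lra.
- by rewrite opprK ltrN2.
- by rewrite opprK lerN2.
exists (- d); split; [lra|lra|lra|move=> t /andP[t1 t2]].
by have := d4 (- t); rewrite opprK ltrN2; apply; apply/andP; split; lra.
Qed.

(** The first time at the upper level and, before it, the last time at the lower
    one enclose a passage strictly between the levels. *)
Lemma continuous_crossing h a b r1 r2 : a <= b ->
  (forall t, a <= t <= b -> {for t, continuous h}) ->
  h a <= r1 -> r1 < r2 -> r2 <= h b ->
  exists c d, [/\ [/\ a <= c, c < d & d <= b], h c = r1, h d = r2 &
    forall t, c < t < d -> r1 < h t < r2].
Proof.
move=> ab hc h1 r12 h2.
have [d [ad db hd dr]] := first_hit ab hc (le_lt_trans h1 r12) h2.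
have [||||c [ac cd hcr cr]] := @last_hit h a d r1 => //.
- exact: ltW.
- by move=> t /andP[t1 t2]; apply: hc; rewrite t1 (le_trans t2).
- by rewrite hd.
exists c, d; split => // t /andP[ct td]; rewrite cr ?ct ?ltW//= dr//.
by rewrite td andbT (le_trans ac)// ltW.
Qed.

End crossing.

Section ring_crossing.
Context {R : realType} {n : nat}.
Implicit Types (D : set 'rV[R]_n) (f : 'rV[R]_n -> 'rV[R]_n) (a v y : 'rV[R]_n).

Let ring_crossing_up D f a v y r1 r2 (rho : 'rV[R]_n -> \bar R) :
  open D -> {in D, continuous f} -> v != 0 ->
  (forall t : R, 0 <= t <= 1 -> D (a + t *: v)) ->
  admissible (preimage_curves D f y r1 r2) rho -> r1 < r2 ->
  enorm (f a - y) <= r1 -> r2 <= enorm (f (a + v) - y) ->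
  (1 <= (enorm v)%:E * \int[lebesgue_measure]_(t in `[0%R, 1%R]) rho (a + t *: v)%R)%E.
Proof.
move=> oD fD v0 segD [rho0 mrho rhoadm] r12 h1 h2.
pose h (t : R) := enorm (f (a + t *: v) - y).
have cf (t : R) : 0 <= t <= 1 -> {for t, continuous (fun t : R => f (a + t *: v))}.
  move=> t01; apply: (@continuous_comp _ _ _ (fun t : R => a + t *: v) f).
    exact: continuous_line.
  by apply: fD; rewrite inE; exact: segD.
have hc (t : R) : 0 <= t <= 1 -> {for t, continuous h}.
  move=> t01; apply: (@continuous_comp _ _ _ (fun t : R => f (a + t *: v) - y) (@enorm R n)).
    by apply: cvgB; [exact: cf|exact: cvg_cst].
  exact: continuous_enorm.
have [||c [d [[c0 cd d1] hcr hdr hcd]]] := continuous_crossing ler01 hc _ r12.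
- by rewrite /h scale0r addr0.
- by rewrite /h scale1r.
have cd01 (t : R) : c <= t <= d -> 0 <= t <= 1.
  by move=> /andP[ct td]; rewrite (le_trans c0 ct) (le_trans td d1).
have := rhoadm (straight_path a v c d); move=> H; apply: le_trans (H _ _) _.
- split.
    split; first by split=> //=; apply: continuous_subspaceT; exact: continuous_line.
    by move=> t tcd; apply: segD; exact: cd01.
  split=> /=.
  + split=> //=; apply: continuous_in_subspaceT => t /[!inE] /= /[!in_itv]/= tcd.
    apply: (@continuous_comp _ _ (one_point_compactification 'rV[R]_n)
      (fun t : R => f (a + t *: v)) Some); first exact/cf/cd01.
    exact: one_point_compactification_some_continuous.
  + by exists (f (a + c *: v)).
  + by exists (f (a + d *: v)).
  + by move=> t tcd; exists (f (a + t *: v)) => //; exact: hcd.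
- exact: locally_rectifiable_straight.
exact: line_integral_straight_le.
Qed.

(** The curves of the family run outwards; a segment whose image runs inwards is
    reversed, which does not change its integral. *)
Lemma ring_crossing D f a v y r1 r2 (rho : 'rV[R]_n -> \bar R) :
  open D -> {in D, continuous f} -> v != 0 ->
  (forall t : R, 0 <= t <= 1 -> D (a + t *: v)) ->
  admissible (preimage_curves D f y r1 r2) rho -> r1 < r2 ->
  Num.min (enorm (f a - y)) (enorm (f (a + v) - y)) <= r1 ->
  r2 <= Num.max (enorm (f a - y)) (enorm (f (a + v) - y)) ->
  (1 <= (enorm v)%:E * \int[lebesgue_measure]_(t in `[0%R, 1%R]) rho (a + t *: v)%R)%E.
Proof.
move=> oD fD v0 segD adm r12.
have [le12|lt21] := leP (enorm (f a - y)) (enorm (f (a + v) - y)).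
  exact: (ring_crossing_up oD fD v0 segD adm r12).
move=> h1 h2.
have [rho0 mrho _] := adm.
have rev (t : R) : a + v + t *: - v = a + (1 - t) *: v.
  by rewrite scalerN scalerBl scale1r addrA.
have := @ring_crossing_up D f (a + v) (- v) y r1 r2 rho oD fD.
rewrite oppr_eq0 addrK enormN => H; apply: le_trans (H _ _ _ _ _ _) _ => //.
  by move=> t t01; rewrite rev; apply: segD; move: t01 => /andP[? ?]; apply/andP; split; lra.
apply: lee_wpmul2l; first by rewrite lee_fin enorm_ge0.
pose g (t : R) : \bar R := ((fun t : R => rho (a + t *: v)) \_ `[0%R, 1%R]) t.
have g0 (t : R) : (0 <= g t)%E by apply: erestrict_ge0.
have mg : measurable_fun setT g.
  apply/(measurable_restrictT _ _).1 => //; apply: measurable_funTS.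
  exact: (measurableT_comp mrho (measurable_line a v)).
have N10 : -1 != 0 :> R by rewrite oppr_eq0 oner_eq0.
have := ge0_integral_affine_line 1 (measurable_itv `[0, 1]%R) N10 g0 mg.
rewrite normrN1 invr1 mul1e /g -integral_mkcond; apply: le_trans.
rewrite le_eqVlt; apply/orP; left; apply/eqP; apply: eq_integral => t.
rewrite inE /= in_itv/= => /andP[t0 t1]; rewrite patchE mem_set; last first.
  by rewrite /= in_itv/=; apply/andP; split; lra.
by rewrite rev; congr (rho (a + _ *: v)); ring.
Qed.

End ring_crossing.

(** * Points over a ray *)

Section ray_lifting.
Context {R : realType} {n : nat}.
Implicit Types (D : set 'rV[R]_n) (f : 'rV[R]_n -> 'rV[R]_n) (x v p : 'rV[R]_n).

Lemma continuous_normB (x0 : 'rV[R]_n) : continuous (fun z : 'rV[R]_n => `|z - x0|).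
Proof.
move=> z; apply: (@cvg_norm _ _ _ _ (nbhs_filter z)).
apply: (@cvgB _ _ _ _ (nbhs_filter z)); first exact: cvg_id.
exact: (@cvg_cst _ _ _ _ (nbhs_filter z)).
Qed.

Lemma closed_cube_compact (x0 : 'rV[R]_n) (t : R) : compact [set z : 'rV[R]_n | `|z - x0| <= t].
Proof.
apply: bounded_closed_compact.
  exists (`|x0| + t); split; first exact: num_real.
  move=> M Mt z /= zt; apply: le_trans (ltW Mt).
  by rewrite -[z in leLHS](subrK x0) (le_trans (ler_normD _ _))// addrC lerD2l.
apply: (@preimage_closed _ _ (fun z : 'rV[R]_n => `|z - x0|) [set r | r <= t]).
  by move=> z _; exact: continuous_normB.
exact: closed_le.
Qed.

(** Let S be the set of parameters of the points of the ray that lie under the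
    cube. It is closed and bounded, since the cube is compact; if no point on
    the boundary of the cube lay over the ray, S would be open in the half-line
    as well, [f] being open. The supremum of S refutes this. *)
Lemma ray_meets_cube_boundary D f (x0 : 'rV[R]_n) (t : R) x v :
  open_mapping D f -> {in D, continuous f} ->
  (forall z, `|z - x0| <= t -> D z) -> `|x - x0| < t -> v != 0 ->
  exists p, exists2 l : R, `|p - x0| = t /\ 0 <= l & f p = f x + l *: v.
Proof.
move=> oF cf cubeD xt v0.
pose K := [set z : 'rV[R]_n | `|z - x0| <= t].
pose B := [set z : 'rV[R]_n | `|z - x0| < t].
have oB : open B.
  apply: (@open_comp _ _ (fun z : 'rV[R]_n => `|z - x0|) [set r | r < t]).
    by move=> z _; exact: continuous_normB.
  exact: open_lt.
have ofB : open (f @` B) by apply: oF => // z /ltW; exact: cubeD.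
have cK : compact (f @` K).
  apply: continuous_compact; last exact: closed_cube_compact.
  by apply: continuous_in_subspaceT => z /[!inE] Kz; apply: cf; rewrite inE; exact: cubeD.
have clK : closed (f @` K) by apply: compact_closed => //; exact: norm_hausdorff.
have [M [_ bM]] : bounded_set (f @` K) by exact: compact_bounded.
pose S := [set l : R | 0 <= l /\ (f @` K) (f x + l *: v)].
have S0 : S 0 by split=> //; exists x; [exact: ltW|rewrite scale0r addr0].
have w0 : 0 < `|v| by rewrite normr_gt0.
have ubS : ubound S ((M + 1 + `|f x|) / `|v|).
  move=> l [l0 Kl]; rewrite ler_pdivlMr//.
  have MM : M < M + 1 by rewrite ltrDl.
  have /= := bM (M + 1) MM _ Kl.
  have : `|l *: v| <= `|f x + l *: v| + `|f x|.
    by rewrite -[X in `|X| <= _](addKr (f x)) addrC (le_trans (ler_normB _ _)).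
  by rewrite normrZ ger0_norm//; lra.
have supS : has_sup S by split; [exists 0|exists ((M + 1 + `|f x|) / `|v|)].
have S0' : 0 <= sup S by apply: ub_le_sup => //; exists ((M + 1 + `|f x|) / `|v|).
have cline : continuous (fun l : R => f x + l *: v) by exact: continuous_line.
have near_sup (U : set 'rV[R]_n) : open U -> U (f x + sup S *: v) ->
    exists2 e : R, 0 < e & forall l, ball (sup S) e l -> U (f x + l *: v).
  move=> oU Us.
  have : nbhs (sup S) [set l : R | U (f x + l *: v)].
    by apply: (cline (sup S)); exact: open_nbhs_nbhs.
  by move=> /nbhs_ballP[e e0 he]; exists e.
have [p Kp fp] : (f @` K) (f x + sup S *: v).
  apply: contrapT => nK.
  have [e e0 he] := near_sup (~` (f @` K)) (closed_openC clK) nK.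
  have [l [l0 Kl] le] := sup_adherent e0 supS.
  have lS : l <= sup S by apply: ub_le_sup => //; exists ((M + 1 + `|f x|) / `|v|).
  by apply: (he l) => //; rewrite /ball/= ger0_norm; lra.
exists p, (sup S) => //; split=> //.
apply/eqP; rewrite eq_le Kp leNgt /=; apply/negP => pt.
have [e e0 he] := near_sup (f @` B) ofB (ex_intro2 _ _ p pt fp).
have Se : S (sup S + e / 2).
  split; first by rewrite addr_ge0// divr_ge0// ltW.
  have [q Bq fq] : (f @` B) (f x + (sup S + e / 2) *: v).
    by apply: he; rewrite /ball/= opprD addNKr normrN gtr0_norm; lra.
  by exists q => //; exact: ltW.
have : sup S + e / 2 <= sup S.
  by apply: ub_le_sup => //; exists ((M + 1 + `|f x|) / `|v|).
lra.
Qed.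

End ray_lifting.

(** * Weights for the rings *)

Section ring_weights.
Context {R : realType} {n : nat}.
Hypothesis n0 : (0 < n)%N.
Local Open Scope ereal_scope.
Local Notation m := (@lebesgue_measureRn R n).
Local Notation mB := (@borel_measureRn R n).
Implicit Types (D : set 'rV[R]_n) (f : 'rV[R]_n -> 'rV[R]_n)
  (Q : 'rV[R]_n -> \bar R) (y : 'rV[R]_n).

Lemma annulus_open y (r1 r2 : R) : open (annulus y r1 r2).
Proof.
have -> : annulus y r1 r2 = (fun z => enorm (z - y)) @^-1` `]r1, r2[%classic.
  by apply/seteqP; split=> z; rewrite /= in_itv.
apply: open_comp; last exact: interval_open.
move=> z _; apply: (@continuous_comp _ _ _ (fun z : 'rV[R]_n => z - y)%R (@enorm R n)).
  apply: (@cvgB _ _ _ _ (nbhs_filter z)); first exact: cvg_id.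
  exact: (@cvg_cst _ _ _ _ (nbhs_filter z)).
exact: continuous_enorm.
Qed.

Lemma open_lebesgue_measurable (U : set 'rV[R]_n) : open U ->
  measurable (U : set (lebesgueRn R n)).
Proof.
by move=> oU; apply: borel_lebesgue_measurable; exact: sub_sigma_algebra.
Qed.

Lemma measurable_expe d (T : measurableType d) (h : T -> \bar R) k :
  measurable_fun setT h -> measurable_fun setT (fun x => h x ^+ k).
Proof.
move=> mh; elim: k => [|k IHk]; first exact: measurable_cst.
rewrite (_ : (fun _ => _) = (fun x => h x * h x ^+ k)); first exact: emeasurable_funM.
by apply/funext => x; rewrite expeS.
Qed.

(** The inverse Poletsky inequality for the constant function of integral 1. *)
Lemma modulus_ring_le D f Q y (r1 r2 : R) :
  open_mapping D f -> open D -> (forall x, 0 <= Q x) ->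
  measurable_fun setT (Q : lebesgueRn R n -> \bar R) ->
  inverse_poletsky D f Q y -> (0 < r1)%R -> (r1 < r2)%R ->
  modulus (preimage_curves D f y r1 r2) <=
  ((r2 - r1) ^- n)%:E * \int[m]_(x in annulus y r1 r2) Q x.
Proof.
move=> of_ oD Q0 mQ iP r10 r12.
have h0 : (0 < r2 - r1)%R by rewrite subr_gt0.
have h0' : (0 <= (r2 - r1)^-1)%R by rewrite invr_ge0 ltW.
apply: le_trans (iP r1 r2 r10 r12 (cst ((r2 - r1)^-1)%:E) _ _ _) _.
- by move=> r _; rewrite lee_fin.
- exact: measurable_cst.
- rewrite integral_cst//; last exact: sub_caratheodory.
  rewrite [X in _ * X](_ : _ = (r2 - r1)%:E); last first.
    transitivity (lebesgue_measure `]r1, r2[%classic) => //.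
    by rewrite lebesgue_measure_itv /= lte_fin r12 EFinB.
  by rewrite -EFinM mulVf// gt_eqF.
have mA := open_lebesgue_measurable (@annulus_open y r1 r2).
set F := fun x : 'rV[R]_n => _.
have FE x : F x = (((r2 - r1) ^- n)%:E * Q x) * (\1_(annulus y r1 r2) x)%:E.
  rewrite /F patchE indicE.
  have -> : (enorm (x - y) \in `]r1, r2[%classic) = (x \in annulus y r1 r2).
    by apply/idP/idP; rewrite !inE /annulus /= ?in_itv.
  case: ifPn => _; last first.
    by rewrite mule0 -(prednK n0) expeS mul0e mule0.
  by rewrite mule1 -EFin_expe exprVn muleC.
have mF : measurable_fun setT (F : lebesgueRn R n -> \bar R).
  rewrite (_ : F = fun x => (((r2 - r1) ^- n)%:E * Q x) * (\1_(annulus y r1 r2) x)%:E); last first.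
    by apply/funext => x; rewrite FE.
  apply: emeasurable_funM; first exact: measurable_funeM.
  by apply/measurable_EFinP/measurable_indic.
have c0 : 0 <= ((r2 - r1) ^- n)%:E :> \bar R by rewrite lee_fin invr_ge0 exprn_ge0// ltW.
apply: (@le_trans _ _ (\int[m]_x F x)).
  apply: ge0_subset_integral => //.
    exact/open_lebesgue_measurable/of_.
  move=> x _; change (0 <= F x); rewrite FE.
  by apply: mule_ge0; [exact: mule_ge0|rewrite lee_fin].
rewrite -ge0_integralZl//; last exact: measurable_funTS.
rewrite le_eqVlt; apply/orP; left; apply/eqP.
rewrite [RHS]integral_mkcond; apply: eq_integral => x _.
by rewrite FE patchE indicE; case: ifPn => _; rewrite ?mule1 ?mule0.
Qed.

(** The rings of width [h] around [y] are disjoint, so near-optimal weights for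
    all of them can be added up at the expense of a single norm of [Q]. *)
Lemma ring_weights D f Q y (h eps : R) :
  open_mapping D f -> open D -> (forall x, 0 <= Q x) ->
  measurable_fun setT (Q : lebesgueRn R n -> \bar R) ->
  m.-integrable setT Q ->
  inverse_poletsky D f Q y -> (0 < h)%R -> (0 < eps)%R ->
  exists g : 'rV[R]_n -> \bar R,
    [/\ forall x, 0 <= g x,
        measurable_fun setT (g : borelRn R n -> \bar R),
        \int[mB]_x g x <= (h ^- n)%:E * \int[m]_x Q x + eps%:E &
        forall k : nat, exists rho, admissible
          (preimage_curves D f y (k.+1%:R * h) (k.+2%:R * h)) rho /\
          forall x, rho x ^+ n <= g x].
Proof.
move=> of_ oD Q0 mQ iQ iP h0 eps0.
pose A k : set (lebesgueRn R n) := annulus y (k.+1%:R * h) (k.+2%:R * h).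
have mA k : measurable (A k) by exact/open_lebesgue_measurable/annulus_open.
have tA : trivIset setT A.
  apply/trivIsetP => i j _ _ ij; apply/seteqP; split=> // x [/andP[i1 i2] /andP[j1 j2]].
  have := lt_trans i1 j2; have := lt_trans j1 i2; rewrite !ltr_pM2r// !ltr_nat.
  by move: ij => /eqP; lia.
have cn0 : 0 <= (h ^- n)%:E :> \bar R by rewrite lee_fin invr_ge0 exprn_ge0// ltW.
pose B k := (h ^- n)%:E * \int[m]_(x in A k) Q x.
have B0 k : 0 <= B k by rewrite mule_ge0// integral_ge0.
have modB k : modulus (preimage_curves D f y (k.+1%:R * h) (k.+2%:R * h)) <= B k.
  have := @modulus_ring_le D f Q y (k.+1%:R * h) (k.+2%:R * h) of_ oD Q0 mQ iP.
  rewrite -mulrBl -natrB// subSnn mul1r; apply; first by rewrite mulr_gt0.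
  by rewrite ltr_pM2r// ltr_nat.
have rhoP k : {rho | admissible (preimage_curves D f y (k.+1%:R * h) (k.+2%:R * h)) rho /\
    \int[mB]_x (rho x ^+ n) <= B k + (eps / (2 ^ k.+1)%:R)%:E}.
  apply: cid.
  have ek : (0 < eps / (2 ^ k.+1)%:R)%R by rewrite divr_gt0// ltr0n expn_gt0.
  have modfin : modulus (preimage_curves D f y (k.+1%:R * h) (k.+2%:R * h)) \is a fin_num.
    rewrite ge0_fin_numE; last first.
      apply: le_ereal_inf_tmp => _ [r [r0 _ _] <-]; apply: integral_ge0 => x _.
      exact: expe_ge0.
    apply: le_lt_trans (modB k) _; rewrite /B lte_mul_pinfty//.
    apply: le_lt_trans (integrableP _ _ _ iQ).2.
    apply: (@le_trans _ _ (\int[m]_x Q x)); first exact: ge0_subset_integral.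
    by rewrite le_eqVlt; apply/orP; left; apply/eqP; apply: eq_integral => x _; rewrite gee0_abs.
  have [_ [rho adm <-] /ltW lt] := lb_ereal_inf_adherent ek modfin.
  exists rho; split=> //; case: adm => rho0 mrho _.
  rewrite -ge0_integral_borel; last 2 first.
  - by move=> x; rewrite expe_ge0.
  - exact: measurable_expe.
  by apply: le_trans lt _; rewrite leeD2r// modB.
pose rho k := sval (rhoP k).
have rho0 k x : 0 <= rho k x by rewrite /rho; case: (rhoP k) => r /= [[]].
have mrho k : measurable_fun setT (rho k : borelRn R n -> \bar R).
  by rewrite /rho; case: (rhoP k) => r /= [[]].
exists (fun x => \sum_(k <oo) rho k x ^+ n); split.
- by move=> x; apply: nneseries_ge0 => k _ _; exact: expe_ge0.
- apply: ge0_emeasurable_sum => [k x _ _|k _]; first exact: expe_ge0.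
  exact: measurable_expe.
- rewrite integral_nneseries//; last 2 first.
  + by move=> k; exact: measurable_expe.
  + by move=> k x _; exact: expe_ge0.
  apply: (@le_trans _ _ (\sum_(k <oo) (B k + (eps / (2 ^ k.+1)%:R)%:E))).
    apply: lee_nneseries => [k _ _|k _].
      by apply: integral_ge0 => x _; exact: expe_ge0.
    by rewrite /rho; case: (rhoP k) => r /= [].
  apply: (le_trans (epsilon_trick _ B0 (ltW eps0))).
  rewrite leeD2r// /B nneseriesZl//; last by move=> k _; exact: integral_ge0.
  rewrite lee_wpmul2l//.
  rewrite -ge0_integral_bigcup//; last 1 first.
  + exact: measurable_funTS.
  apply: ge0_subset_integral => //; exact: bigcup_measurable.
- move=> k; exists (rho k); split.
    by rewrite /rho; case: (rhoP k) => r /= [].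
  move=> x; have rn0 i : true -> 0 <= rho i x ^+ n by move=> _; exact: expe_ge0.
  apply: le_trans (nneseries_lim_ge k.+1 (fun i _ => rn0 i)).
  by rewrite big_nat_recr//= leeDr// sume_ge0// => i _; exact: rn0.
Qed.

End ring_weights.

(** * Lower bound over the boundary of a cube *)

Section segment_oscillation.
Context {R : realType} {n : nat}.
Hypothesis n0 : (0 < n)%N.
Local Open Scope ereal_scope.
Implicit Types (D : set 'rV[R]_n) (f : 'rV[R]_n -> 'rV[R]_n)
  (g : 'rV[R]_n -> \bar R) (a v y : 'rV[R]_n).

Definition weighs_rings D f g y (h : R) := forall k : nat, exists rho, admissible
  (preimage_curves D f y (k.+1%:R * h) (k.+2%:R * h)) rho /\
  forall x, rho x ^+ n <= g x.

(** An interval of length [2 * h] in the half-line contains two consecutive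
    multiples of [h], the smaller one positive: these are the radii of a ring
    that the image of the segment passes through. *)
Lemma segment_oscillation D f g y a v (h : R) (dl : R -> R) :
  open D -> {in D, continuous f} -> (forall t : R, (0 <= t <= 1)%R -> D (a + t *: v)%R) ->
  (forall x, 0 <= g x) -> measurable_fun setT (g : borelRn R n -> \bar R) ->
  weighs_rings D f g y h -> (0 < h)%R ->
  (forall t : R, (0 < t <= 1)%R -> (0 < dl t)%R) ->
  measurable_fun (`]0%R, 1%R]%classic : set R)
    (fun t : R => @young_cost R n (dl t) (g (a + t *: v)%R)) ->
  (2 * h <= `|enorm (f a - y) - enorm (f (a + v) - y)|)%R ->
  1 <= (enorm v)%:E * \int[lebesgue_measure]_(t in `]0%R, 1%R])
          @young_cost R n (dl t) (g (a + t *: v)%R).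
Proof.
move=> oD fD segD g0 mg wg h0 dl0 mY osc.
have v0 : (v != 0)%R.
  apply/eqP => vE; move: osc; rewrite vE addr0 subrr normr0; lra.
pose A := Num.min (enorm (f a - y)%R) (enorm (f (a + v) - y)%R).
pose B := Num.max (enorm (f a - y)%R) (enorm (f (a + v) - y)%R).
have AB : (A + 2 * h <= B)%R.
  move: osc; rewrite /A /B /Num.max /Num.min; case: ltP => ?.
    by rewrite ltr0_norm ?subr_lt0//; lra.
  by rewrite ger0_norm ?subr_ge0//; lra.
have A0 : (0 <= A / h)%R by rewrite divr_ge0 ?(ltW h0)// le_min !enorm_ge0.
pose k := Num.truncn (A / h)%R.
have /andP[k1 k2] := truncn_itv A0.
have Ak : (A <= k.+1%:R * h)%R by rewrite -ler_pdivrMr//; exact: ltW.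
have kB : (k.+2%:R * h <= B)%R.
  apply: le_trans AB; rewrite -addn2 natrD mulrDl lerD2r.
  by rewrite -ler_pdivlMr.
have [rho [adm rhog]] := wg k.
have rr : (k.+1%:R * h < k.+2%:R * h)%R by rewrite ltr_pM2r// ltr_nat.
have := ring_crossing oD fD v0 segD adm rr Ak kB; move=> H; apply: le_trans H _.
have [rho0 mrho _] := adm.
apply: lee_wpmul2l; first by rewrite lee_fin enorm_ge0.
have mr : measurable_fun setT (fun t : measurableTypeR R => rho (a + t *: v)%R).
  exact: (measurableT_comp mrho (measurable_line a v)).
rewrite -integral_itv_obnd_cbnd; last exact: measurable_funTS.
apply: ge0_le_integral => //.
- exact: measurable_funTS.
- by move=> t; rewrite /= in_itv/= => t01; apply: le_young_cost => //; exact: dl0.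
Qed.

End segment_oscillation.

Section face_estimate.
Context {R : realType} {n : nat}.
Hypothesis n0 : (0 < n)%N.
Local Open Scope ereal_scope.
Implicit Types (D : set 'rV[R]_n) (f : 'rV[R]_n -> 'rV[R]_n)
  (g : 'rV[R]_n -> \bar R) (a v y c u : 'rV[R]_n) (i j : 'I_n) (b : bool).

Let norm_sign b : `|(-1) ^+ b : R|%R = 1%R.
Proof. by rewrite normrX normrN1 expr1n. Qed.

Lemma norm_face_segment i b J c (s : R) u : (forall j, `|c ord0 j| <= 1)%R ->
  cube 1 u -> (0 <= s <= 1)%R -> (`|face_segment i b J c s u| <= 1)%R.
Proof.
move=> c1 /cubeP u1 /andP[s0 s1].
rewrite [leLHS]/Num.norm/= mx_normrE; apply: bigmax_le => // -[k j] _ /=.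
rewrite (ord1 k) mxE; case: (j == i); first by rewrite norm_sign.
have uj : (`|u ord0 j| <= 1)%R.
  by have /andP[/ltW ? ?] := u1 j; rewrite ler_norml; apply/andP.
case: (J j) => //; apply: (le_trans (ler_normD _ _)); rewrite !normrM.
rewrite (ger0_norm s0) ger0_norm ?subr_ge0//.
have := c1 j; have := normr_ge0 (c ord0 j); have := normr_ge0 (u ord0 j); nra.
Qed.

Lemma segment_cost_ge1 D f g y (x0 : 'rV[R]_n) (h k t : R) i b J c u :
  open D -> {in D, continuous f} -> (0 < t)%R -> (0 < k)%R -> (0 < h)%R ->
  (forall z, (`|z - x0| <= t)%R -> D z) ->
  (forall x, 0 <= g x) -> measurable_fun setT (g : borelRn R n -> \bar R) ->
  weighs_rings D f g y h -> (forall j, `|c ord0 j| <= 1)%R -> cube 1 u ->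
  (2 * h <= `|enorm (f (x0 + t *: face_segment i b J c 0 u) - y) -
              enorm (f (x0 + t *: face_segment i b J c 1 u) - y)|)%R ->
  1 <= (2 * n%:R * t)%:E * segment_cost (fun z => g (x0 + z)%R) i b J c k t u.
Proof.
move=> oD fD t0 k0 h0 cubeD g0 mg wg c1 u1 osc.
have fs1 s : (0 <= s <= 1)%R -> (`|face_segment i b J c s u| <= 1)%R.
  exact: norm_face_segment.
pose a := (x0 + t *: face_segment i b J c 0 u)%R.
pose v := (t *: (face_segment i b J c 1 u - face_segment i b J c 0 u))%R.
have avE s : (a + s *: v = x0 + t *: face_segment i b J c s u)%R.
  rewrite /a /v; apply/rowP => l; rewrite !mxE.
  by case: (l == i); [|case: (J l)]; ring.
have avE1 : (a + v = x0 + t *: face_segment i b J c 1 u)%R by rewrite -avE scale1r.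
have wpos s : (0 < s)%R -> (0 < k / t * weight n s)%R.
  by move=> s0; rewrite mulr_gt0 ?divr_gt0// weight_gt0.
have := @segment_oscillation R n n0 D f g y a v h (fun s => k / t * weight n s)%R
  oD fD _ g0 mg wg h0 _ _ _; move=> H; apply: le_trans (H _ _ _ _) _.
- move=> s s01; rewrite avE; apply: cubeD.
  rewrite addrC addKr normrZ gtr0_norm// -[leRHS]mulr1 ler_pM2l//.
  exact: fs1.
- by move=> s /andP[s0 _]; exact: wpos.
- apply: measurable_funTS; apply: measurable_young_cost.
  + by move=> s; rewrite mulr_ge0 ?powR_ge0// divr_ge0// ltW.
  + by apply: measurable_funM => //; exact: measurable_weight.
  + exact: (measurableT_comp mg (measurable_line a v)).
- by rewrite avE1.
rewrite /segment_cost; under eq_integral do rewrite avE.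
apply: lee_wpmul2r.
  by apply: integral_ge0 => s; rewrite /= in_itv/= => /andP[s0 _];
    apply: young_cost_ge0 => //; exact/ltW/wpos.
rewrite lee_fin; apply: (le_trans (enorm_le_norm _)).
rewrite /v normrZ gtr0_norm// (_ : 2 * n%:R * t = n%:R * (t * 2))%R; last by ring.
rewrite ler_wpM2l// ler_pM2l//; apply: (le_trans (ler_normB _ _)).
by have := fs1 0%R; have := fs1 1%R; rewrite ler01 !lexx => /(_ isT) ? /(_ isT) ?; lra.
Qed.

End face_estimate.

Section good_point.
Context {R : realType} {n : nat}.
Hypothesis n0 : (0 < n)%N.
Local Open Scope ereal_scope.
Local Notation mB := (@borel_measureRn R n).
Implicit Types (g : 'rV[R]_n -> \bar R).

Lemma sume_const (T : finType) (x : \bar R) : 0 <= x ->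
  \sum_(z : T) x = #|T|%:R%:E * x.
Proof.
move=> x0; rewrite big_const; elim: #|T| => [|N IHN]; first by rewrite mul0e.
by rewrite iterS IHN -natr1 EFinD ge0_muleDl ?lee_fin// mul1e addeC.
Qed.

Lemma cube1_fin_num : mB (cube 1) \is a fin_num.
Proof.
rewrite ge0_fin_numE//; apply: le_lt_trans (borel_measure_box_le _) _.
exact: ltry.
Qed.

Definition faces_integral g (t : R) : \bar R :=
  \sum_(z : 'I_n * bool) face_integral g z.1 z.2 t.

Lemma face_integral_le g i b t : (forall x, 0 <= g x) ->
  face_integral g i b t <= faces_integral g t.
Proof.
move=> g0; rewrite /faces_integral (bigD1 (i, b))//= leeDl// sume_ge0// => z _.
exact: face_integral_ge0.
Qed.

(** The mean over the cube of the costs of finitely many segments is small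
    unless the weight is large on the faces: the factor [k] makes the part of
    the mean that does not depend on [g] at most one half. *)
Lemma exists_good_point (T : finType) (fi : T -> 'I_n) (fb : T -> bool)
    (fJ : T -> pred 'I_n) (fc : T -> 'rV[R]_n) g (t : R) :
  (0 < #|T|)%N -> (0 < t)%R ->
  (forall x, 0 <= g x) -> measurable_fun setT (g : borelRn R n -> \bar R) ->
  let k := ((4 * n%:R ^+ 2 * #|T|%:R)^-1)%R in
  mB (cube 1) <= (k ^- n * t)%:E * faces_integral g t \/
  exists2 u, cube 1 u & forall z, (2 * n%:R * t)%:E *
    segment_cost g (fi z) (fb z) (fJ z) (fc z) k t u < 1.
Proof.
move=> T0 t0 g0 mg k.
have TR0 : (0 < #|T|%:R :> R)%R by rewrite ltr0n.
have nR0 : (0 < n%:R :> R)%R by rewrite ltr0n.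
have k0 : (0 < k)%R by rewrite invr_gt0 !mulr_gt0// exprn_gt0.
pose F z u := segment_cost g (fi z) (fb z) (fJ z) (fc z) k t u.
have F0 z u : 0 <= F z u by exact: segment_cost_ge0.
have mF z : measurable_fun setT (F z : borelRn R n -> \bar R) by exact: measurable_segment_cost.
have G0 : 0 <= faces_integral g t by apply: sume_ge0 => z _; exact: face_integral_ge0.
have [good|bad] := pselect (exists2 u, cube 1 u & forall z, (2 * n%:R * t)%:E * F z u < 1).
  by right.
left.
have c0 : (0 <= 2 * n%:R * t)%R by rewrite !mulr_ge0// ltW.
have bad1 u : cube 1 u -> 1 <= (2 * n%:R * t)%:E * \sum_z F z u.
  move=> Qu; rewrite leNgt; apply/negP => small; apply: bad; exists u => // z.
  apply: le_lt_trans small; rewrite lee_wpmul2l ?lee_fin// (bigD1 z)//=.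
  by rewrite leeDl// sume_ge0.
have mS : measurable_fun setT ((fun u => \sum_z F z u) : borelRn R n -> \bar R).
  exact: emeasurable_sum.
have : mB (cube 1) <= (2 * n%:R * t)%:E * \sum_z \int[mB]_(u in cube 1) F z u.
  rewrite -ge0_integral_sum//; last 2 first.
  - exact: measurable_cube.
  - by move=> z; exact: measurable_funTS.
  rewrite -ge0_integralZl//; last 3 first.
  - exact: measurable_cube.
  - exact: measurable_funTS.
  - by move=> u _; exact: sume_ge0.
  rewrite -[leLHS]mul1e -(integral_cst mB); last exact: measurable_cube.
  apply: ge0_le_integral => //.
  - exact: measurable_cube.
  - by apply: measurable_funTS; exact: measurable_funeM.
pose E := (k / t * n%:R)%:E * mB (cube 1) + (n%:R * k ^- n.-1)%:E * faces_integral g t.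
have FE z : \int[mB]_(u in cube 1) F z u <= E.
  apply: (le_trans (integral_segment_cost_le _ _ _ _ _ _ _ _ _)) => //.
  rewrite leeD2l// lee_wpmul2l//; first by rewrite lee_fin mulr_ge0 ?invr_ge0 ?exprn_ge0// ltW.
  exact: face_integral_le.
move=> H.
have {H} : mB (cube 1) <= (2 * n%:R * t * #|T|%:R)%:E * E.
  apply: (le_trans H); rewrite [in leRHS]EFinM -muleA lee_wpmul2l ?lee_fin//.
  rewrite -sume_const; last first.
    apply: adde_ge0; apply: mule_ge0 => //; rewrite lee_fin.
      by rewrite mulr_ge0 ?divr_ge0 ?(ltW k0) ?(ltW t0).
    by rewrite mulr_ge0// invr_ge0 exprn_ge0// ltW.
  by apply: lee_sum => z _; exact: FE.
rewrite /E; have := cube1_fin_num; have := measure_ge0 mB (cube 1).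
case: (mB (cube 1)) => [m| |]// m0 _.
case: (faces_integral g t) G0 => [G| |]//= G0; last first.
  have c1 : 0 < (k ^- n * t)%:E by rewrite lte_fin mulr_gt0// invr_gt0 exprn_gt0.
  by rewrite (gt0_muley c1) leey.
rewrite -!EFinM !lee_fin => H.
have kE : (k * (4 * n%:R ^+ 2 * #|T|%:R) = 1)%R.
  by rewrite mulVf// gt_eqF// !mulr_gt0// exprn_gt0.
have knE : (k ^- n = k^-1 * k ^- n.-1)%R by rewrite -[in LHS](prednK n0) exprS invfM.
have kVE : (k^-1 = 4 * n%:R ^+ 2 * #|T|%:R)%R by rewrite invrK.
have e1 : (2 * n%:R * t * #|T|%:R * (k / t * n%:R * m + n%:R * k ^- n.-1 * G) =
  (k * (4 * n%:R ^+ 2 * #|T|%:R)) * m / 2 + k ^- n * t * G / 2)%R.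
  by rewrite knE kVE; move: (k ^- n.-1)%R => K; field; rewrite gt_eqF.
by move: H; rewrite e1 kE; lra.
Qed.

End good_point.

Section face_lower_bound.
Context {R : realType} {n : nat}.
Hypothesis n1 : (1 < n)%N.
Local Open Scope ereal_scope.
Local Notation mB := (@borel_measureRn R n).
Implicit Types (D : set 'rV[R]_n) (f : 'rV[R]_n -> 'rV[R]_n)
  (g : 'rV[R]_n -> \bar R) (i j : 'I_n) (b : bool).

Let n0 : (0 < n)%N. Proof. exact: ltnW. Qed.

(** The stars from [p] (true) and [q] (false), and for all pairs of faces the
   segments in the first one to its edge with the second one *)
Let legs : finType := (bool + ('I_n * bool) * ('I_n * bool))%type.

(** The inverse of the factor [k] of [exists_good_point] for the family
    [legs]. *)
Definition shell_constant : R := (4 * n%:R ^+ 2 * (2 + (n * 2) * (n * 2))%:R)%R.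

Lemma face_of (w : 'rV[R]_n) (t : R) : (0 < t)%R -> `|w|%R = t ->
  exists i b, w ord0 i = ((-1) ^+ b * t)%R.
Proof.
move=> t0 wt; have w0 : mx_norm w != 0%R by rewrite gt_eqF//; move: t0; rewrite -wt.
have [[k i] /= wi] := mx_norm_neq0 w0; rewrite (ord1 k) in wi.
have {}wi : `|w ord0 i|%R = t by rewrite -wt -wi.
exists i, (w ord0 i < 0)%R; case: ltP => wi0.
  by rewrite expr1 -wi ltr0_norm// mulN1r opprK.
by rewrite expr0 mul1r -wi ger0_norm.
Qed.

(** For a good point [u] each segment changes the distance to the center by
    less than [2 * h]. A passage between adjacent faces takes two segments, one
    between opposite faces goes through a third face, and the two stars add two
    more segments: at most six in total, hence the factor 12. *)
Lemma face_lower_bound D f g y (x0 p q : 'rV[R]_n) (h t : R) :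
  open D -> {in D, continuous f} -> (0 < t)%R -> (0 < h)%R ->
  (forall z, (`|z - x0| <= t)%R -> D z) ->
  (forall x, 0 <= g x) -> measurable_fun setT (g : borelRn R n -> \bar R) ->
  weighs_rings D f g y h -> (`|p - x0| = t)%R -> (`|q - x0| = t)%R ->
  (12 * h <= `|enorm (f p - y) - enorm (f q - y)|)%R ->
  mB (cube 1) <= (shell_constant ^+ n * t)%:E *
    faces_integral (fun z => g (x0 + z)%R) t.
Proof.
move=> oD fD t0 h0 cubeD g0 mg wg pt qt pq.
have [ip [bp pE]] := face_of t0 pt.
have [iq [bq qE]] := face_of t0 qt.
pose sgn b : R := ((-1) ^+ b)%R.
pose fi (z : legs) := match z with inl c => if c then ip else iq | inr z => z.1.1 end.
pose fb (z : legs) := match z with inl c => if c then bp else bq | inr z => z.1.2 end.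
pose fJ (z : legs) : pred 'I_n := match z with inl _ => predT | inr z => pred1 z.2.1 end.
pose fc (z : legs) : 'rV[R]_n := match z with
  | inl c => (t^-1 *: ((if c then p else q) - x0))%R
  | inr z => const_mx (sgn z.2.2) end.
pose g' (z : 'rV[R]_n) := g (x0 + z)%R.
have mg' : measurable_fun setT (g' : borelRn R n -> \bar R) by exact: measurable_shift.
have cardT : #|legs| = (2 + (n * 2) * (n * 2))%N.
  by rewrite card_sum card_bool !card_prod card_bool card_ord.
have T0 : (0 < #|legs|)%N by rewrite cardT.
have g'0 z : 0 <= g' z by exact: g0.
have [|[u Qu good]] := exists_good_point n0 fi fb fJ fc T0 t0 g'0 mg'.
  by rewrite cardT -/shell_constant -exprVn invrK.
exfalso.
pose k : R := ((4 * n%:R ^+ 2 * #|legs|%:R)^-1)%R.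
have k0 : (0 < k)%R.
  by rewrite invr_gt0 !mulr_gt0 ?exprn_gt0 ?ltr0n// ?cardT.
pose psi (z : 'rV[R]_n) := enorm (f (x0 + t *: z) - y)%R.
have fc1 z j : (`|fc z ord0 j| <= 1)%R.
  case: z => [c|z]; rewrite !mxE; last by rewrite normrX normrN1 expr1n.
  rewrite normrM gtr0_norm ?invr_gt0// mulrC ler_pdivrMr// mul1r.
  have := coord_le_norm (p - x0)%R j; have := coord_le_norm (q - x0)%R j.
  by rewrite pt qt !mxE; case: c.
have leg z : (`|psi (face_segment (fi z) (fb z) (fJ z) (fc z) 0 u) -
               psi (face_segment (fi z) (fb z) (fJ z) (fc z) 1 u)| < 2 * h)%R.
  rewrite ltNge; apply/negP => osc.
  have := segment_cost_ge1 n0 oD fD t0 k0 h0 cubeD g0 mg wg (fc1 z) Qu osc.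
  by rewrite leNgt good.
pose P i b := psi (upd u i (sgn b)).
have star c : (`|psi (t^-1 *: ((if c then p else q) - x0)) -
    (if c then P ip bp else P iq bq)| < 2 * h)%R.
  have := leg (inl c).
  have -> : face_segment (fi (inl c)) (fb (inl c)) (fJ (inl c)) (fc (inl c)) 0 u =
      (t^-1 *: ((if c then p else q) - x0))%R.
    apply/rowP => j; rewrite !mxE /= !mul0r addr0 subr0 mul1r.
    case: eqP => // ->; case: c => /=.
      by have := pE; rewrite !mxE => ->; field; rewrite gt_eqF.
    by have := qE; rewrite !mxE => ->; field; rewrite gt_eqF.
  have -> // : psi (face_segment (fi (inl c)) (fb (inl c)) (fJ (inl c)) (fc (inl c)) 1 u) =
     (if c then P ip bp else P iq bq).
  have e i b w : face_segment i b predT w 1 u = upd u i (sgn b).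
    by apply/rowP => j; rewrite !mxE /= subrr mul0r add0r mul1r.
  by rewrite /P; case: (c); rewrite /= e.
have edge i b j b' : i != j -> (`|P i b - P j b'| < 4 * h)%R.
  move=> ij.
  have e0 i1 b1 j1 b1' : i1 != j1 -> face_segment i1 b1 (pred1 j1) (const_mx (sgn b1')) 0 u =
      upd (upd u i1 (sgn b1)) j1 (sgn b1').
    move=> ij1; apply/rowP => l; rewrite !mxE /=; case: (eqVneq l j1) => [->|lj].
      by rewrite eq_sym (negbTE ij1) mul0r addr0 subr0 mul1r.
    by [].
  have e1 i1 b1 j1 b1' : face_segment i1 b1 (pred1 j1) (const_mx (sgn b1')) 1 u =
      upd u i1 (sgn b1).
    apply/rowP => l; rewrite !mxE /=; case: (l == i1) => //.
    by case: (l == j1) => //; rewrite subrr mul0r add0r mul1r.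
  have := leg (inr ((i, b), (j, b'))); have := leg (inr ((j, b'), (i, b))).
  rewrite /= !e1 !e0//; last by rewrite eq_sym.
  have -> : upd (upd u j (sgn b')) i (sgn b) = upd (upd u i (sgn b)) j (sgn b').
    apply/rowP => l; rewrite !mxE; case: (eqVneq l i) => [->|//].
    by rewrite (negbTE ij).
  rewrite -/(P i b) -/(P j b') !ltr_norml => /andP[? ?] /andP[? ?].
  by apply/andP; split; lra.
have faces : (`|P ip bp - P iq bq| < 8 * h)%R.
  have [ii|ij] := eqVneq ip iq; last by apply: lt_le_trans (edge _ _ _ _ ij) _; lra.
  (* two axes exist, since n > 1 *)
  have [j jip] : exists j : 'I_n, ip != j.
    have [i0|i0] := eqVneq (ip : nat) 0%N.
      by exists (Ordinal n1); apply/eqP => /(congr1 val) /=; rewrite i0.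
    by exists (Ordinal n0); apply/eqP => /(congr1 val) /= ipE; rewrite ipE in i0.
  have := edge ip bp j true jip; have := edge iq bq j true; rewrite -ii => /(_ jip).
  rewrite !ltr_norml => /andP[? ?] /andP[? ?].
  by apply/andP; split; lra.
have psiE z : psi (t^-1 *: (z - x0))%R = enorm (f z - y)%R.
  by rewrite /psi scalerA divff ?gt_eqF// scale1r [(x0 + _)%R]addrC subrK.
have := star true; have := star false; rewrite /= !psiE.
move: pq faces; rewrite leNgt => /negP pq; rewrite !ltr_norml => /andP[? ?] /andP[? ?] /andP[? ?].
by apply: pq; rewrite ltr_norml; apply/andP; split; lra.
Qed.

End face_lower_bound.

(** * Distortion *)

Section shell_integration.
Context {R : realType} {n : nat}.
Local Open Scope ereal_scope.
Local Notation mB := (@borel_measureRn R n).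
Implicit Types (g : 'rV[R]_n -> \bar R).

Lemma integral_inv (a b : R) : (0 < a)%R -> (a < b)%R ->
  \int[lebesgue_measure]_(t in `[a, b]) (t^-1)%:E = (ln (b / a))%:E.
Proof.
move=> a0 ab.
have pos (t : R) : t \in `[a, b]%R -> (0 < t)%R.
  by rewrite in_itv/= => /andP[+ _]; exact: lt_le_trans.
have dln (t : R) : (0 < t)%R -> derivable (@ln R) t 1 /\ derive1 (@ln R) t = (t^-1)%R.
  by move=> t0; have [? ?] := is_derive1_ln t0; split=> //; rewrite derive1E.
have cln (t : R) : (0 < t)%R -> {for t, continuous (@ln R)} by exact: continuous_ln.
rewrite (@continuous_FTC2 _ _ (@ln R))//.
- by rewrite ln_div ?posrE ?(lt_trans a0 ab).
- apply: continuous_in_subspaceT => t /[!inE] tab; apply: inv_continuous.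
  by rewrite gt_eqF// pos.
- split.
  + move=> t /[!in_itv]/= /andP[at' _]; exact: (dln t (lt_trans a0 at')).1.
  + exact/cvg_at_right_filter/cln.
  + exact/cvg_at_left_filter/cln/(lt_trans a0).
- move=> t /[!in_itv]/= /andP[at' _]; exact: (dln t (lt_trans a0 at')).2.
Qed.

Lemma integral_shift_le g (a : 'rV[R]_n) :
  (forall x, 0 <= g x) -> measurable_fun setT (g : borelRn R n -> \bar R) ->
  \int[mB]_z g (a + z)%R <= \int[mB]_z g z.
Proof.
move=> g0 mg.
have := @ge0_integral_affine R n (fun j => a ord0 j) (fun _ => 1%R) setT g measurableT
  (fun _ => ltr01) g0 mg.
rewrite big1// invr1 mul1e; apply: le_trans.
rewrite le_eqVlt; apply/orP; left; apply/eqP; apply: eq_integral => z _.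
by congr g; apply/rowP => j; rewrite !mxE mul1r.
Qed.

(** Each of the [2 * n] faces contributes at most twice the integral of [g]. *)
Lemma shell_lower_bound g (K t0 t1 : R) :
  (forall x, 0 <= g x) -> measurable_fun setT (g : borelRn R n -> \bar R) ->
  (0 <= K)%R -> (0 < t0)%R -> (t0 < t1)%R ->
  (forall t, (t0 <= t <= t1)%R -> mB (cube 1) <= (K * t)%:E * faces_integral g t) ->
  (ln (t1 / t0))%:E * mB (cube 1) <= (K * (4 * n%:R))%:E * \int[mB]_z g z.
Proof.
move=> g0 mg K0 t00 t01 H.
have mf (z : 'I_n * bool) : measurable_fun setT (face_integral g z.1 z.2).
  exact: measurable_face_integral.
have f0 (z : 'I_n * bool) t : 0 <= face_integral g z.1 z.2 t.
  exact: face_integral_ge0.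
have minv : measurable_fun (`[t0, t1]%classic : set R) (fun t : R => (t^-1)%:E).
  apply/measurable_EFinP; apply: subspace_continuous_measurable_fun => //.
  apply: continuous_in_subspaceT => t /[!inE] /=; rewrite in_itv/= => /andP[t0t _].
  by apply: inv_continuous; rewrite gt_eqF// (lt_le_trans t00).
rewrite -integral_inv// -ge0_integralZr//; last first.
  by move=> t /=; rewrite in_itv/= => /andP[t0t _]; rewrite lee_fin invr_ge0 (le_trans _ t0t)// ltW.
apply: (@le_trans _ _ (\int[lebesgue_measure]_(t in `[t0, t1]) (K%:E * faces_integral g t))).
  apply: ge0_le_integral => //.
  - move=> t /=; rewrite in_itv/= => /andP[t0t _].
    by rewrite mule_ge0// lee_fin invr_ge0 (le_trans _ t0t)// ltW.
  - by apply: emeasurable_funM => //; exact: measurable_cst.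
  - apply: measurable_funTS; apply: measurable_funeM; exact: emeasurable_sum.
  move=> t /=; rewrite in_itv/= => tt; have := H t tt.
  have tp : (0 < t)%R by move: tt => /andP[+ _]; exact: lt_le_trans.
  by rewrite lee_pdivrMl// muleA -EFinM mulrC.
rewrite ge0_integralZl//; last 2 first.
- by apply: measurable_funTS; exact: emeasurable_sum.
- by move=> t _; exact: sume_ge0.
rewrite EFinM -muleA lee_wpmul2l//.
apply: (@le_trans _ _ (\int[lebesgue_measure]_t faces_integral g t)).
  by apply: ge0_subset_integral => //; [exact: emeasurable_sum|move=> t _; exact: sume_ge0].
rewrite ge0_integral_sum//.
apply: (@le_trans _ _ (\sum_(z : 'I_n * bool) (2%:E * \int[mB]_x g x))).
  by apply: lee_sum => z _; exact: integral_face_integral_le.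
have G0 : 0 <= \int[mB]_x g x by exact: integral_ge0.
rewrite sume_const ?mule_ge0// card_prod card_bool card_ord muleA -EFinM.
by rewrite le_eqVlt; apply/orP; left; apply/eqP; congr (_%:E * _); rewrite natrM; ring.
Qed.

End shell_integration.

Section distortion.
Context {R : realType} {n : nat}.
Hypothesis n1 : (1 < n)%N.
Local Notation mB := (@borel_measureRn R n).
Local Notation m := (@lebesgue_measureRn R n).
Implicit Types (D : set 'rV[R]_n) (f : 'rV[R]_n -> 'rV[R]_n) (Q : 'rV[R]_n -> \bar R).

Let n0 : (0 < n)%N. Proof. exact: ltnW. Qed.

Definition distortion_constant : R :=
  @shell_constant R n ^+ n * (8 * n%:R) * 12 ^+ n / fine (mB (cube 1)).

Let cube1 : 0 < fine (mB (cube 1)).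
Proof. by rewrite -lte_fin fineK ?cube1_fin_num// cube1_measure_gt0. Qed.

Let shell0 : 0 < @shell_constant R n.
Proof. by rewrite /shell_constant !mulr_gt0// ?exprn_gt0// ltr0n. Qed.

Lemma distortion_constant_gt0 : 0 < distortion_constant.
Proof. by rewrite /distortion_constant !mulr_gt0 ?invr_gt0 ?exprn_gt0// ltr0n. Qed.

(** On the boundary of each intermediate cube the two rays provide points whose
    images have distances to one of the two centers that differ by at least the
    distance of [f x] and [f x0]; so [face_lower_bound] applies to all cubes. *)
Lemma distortion_estimate D Q f (x0 x : 'rV[R]_n) (t0 t1 : R) :
  open D -> (forall y, (0 <= Q y)%E) ->
  measurable_fun setT (Q : lebesgueRn R n -> \bar R) -> m.-integrable setT Q ->
  poletsky_family D Q f -> (forall z, `|z - x0| <= t1 -> D z) ->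
  `|x - x0| < t0 -> t0 < t1 ->
  enorm (f x - f x0) ^+ n * ln (t1 / t0) <=
    distortion_constant * fine (\int[m]_y Q y)%E.
Proof.
move=> oD Q0 mQ iQ [cf of_ _ iP] cubeD xt0 t01.
have t00 : 0 < t0 by exact: le_lt_trans xt0.
have fD : {in D, continuous f} by rewrite -continuous_open_subspace.
have Qfin : (\int[m]_y Q y)%E \is a fin_num by exact: integrable_fin_num.
have Qge0 : 0 <= fine (\int[m]_y Q y)%E by rewrite fine_ge0// integral_ge0.
set d := enorm (f x - f x0).
have d0 : 0 <= d by exact: enorm_ge0.
have [d_eq0|dN0] := eqVneq d 0.
  by rewrite d_eq0 expr0n gt_eqF//= mul0r mulr_ge0// ltW// distortion_constant_gt0.
have {dN0}d0 : 0 < d by rewrite lt_neqAle eq_sym dN0.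
pose v := f x - f x0.
have v0 : v != 0 by apply: contraTneq d0 => vE; rewrite /d -/v vE enorm0 ltxx.
pose h := d / 12; have h0 : 0 < h by rewrite divr_gt0.
have Dx0 : D x0 by apply: cubeD; rewrite subrr normr0 ltW// (lt_trans t00).
have Dx : D x by apply: cubeD; rewrite ltW// (lt_trans xt0).
pose K := @shell_constant R n ^+ n.
have K0 : 0 < K by rewrite exprn_gt0.
(* near-optimal weights exist only up to [eps], which tends to 0 below *)
have key eps : 0 < eps -> ln (t1 / t0) * fine (mB (cube 1)) <=
    K * (4 * n%:R) * (2 * (h ^- n * fine (\int[m]_y Q y)%E + eps)).
  move=> eps0.
  have [g0 [g00 mg0 ig0 wg0]] := ring_weights n0 of_ oD Q0 mQ iQ
    (iP (f x) (ex_intro2 _ _ x Dx erefl)) h0 eps0.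
  have [g1 [g10 mg1 ig1 wg1]] := ring_weights n0 of_ oD Q0 mQ iQ
    (iP (f x0) (ex_intro2 _ _ x0 Dx0 erefl)) h0 eps0.
  pose g z := (g0 z + g1 z)%E.
  have gg0 z : (0 <= g z)%E by exact: adde_ge0.
  have mg : measurable_fun setT (g : borelRn R n -> \bar R) by exact: emeasurable_funD.
  have wr0 : weighs_rings D f g (f x) h.
    move=> k; have [rho [adm le]] := wg0 k; exists rho; split=> // z.
    by rewrite (le_trans (le z))// leeDl.
  have wr1 : weighs_rings D f g (f x0) h.
    move=> k; have [rho [adm le]] := wg1 k; exists rho; split=> // z.
    by rewrite (le_trans (le z))// leeDr.
  pose g' (z : 'rV[R]_n) := g (x0 + z).
  have g'0 z : (0 <= g' z)%E by exact: gg0.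
  have mg' : measurable_fun setT (g' : borelRn R n -> \bar R) by exact: measurable_shift.
  have face t : t0 <= t <= t1 ->
      (mB (cube 1) <= (K * t)%:E * faces_integral g' t)%E.
    move=> /andP[t0t tt1].
    have t_gt0 : 0 < t by exact: lt_le_trans t0t.
    have cubeDt z : `|z - x0| <= t -> D z by move=> zt; apply: cubeD; exact: le_trans tt1.
    have [p [l [pt l0 pE]]] := ray_meets_cube_boundary of_ fD cubeDt (lt_le_trans xt0 t0t) v0.
    have x0t : `|x0 - x0| < t by rewrite subrr normr0.
    have [|q [l' [qt l'0 qE]]] := @ray_meets_cube_boundary _ _ D f x0 t x0 (- v) of_ fD cubeDt x0t.
      by rewrite oppr_eq0.
    (* whichever point is farther out on its ray is compared from the origin
       of the other ray *)
    have [ll'|l'l] := leP l l'.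
      apply: (@face_lower_bound _ _ n1 D f g (f x) x0 p q h t) => //.
      have -> : f p - f x = l *: v by rewrite pE addrC addKr.
      have -> : f q - f x = - (1 + l') *: v.
        by rewrite qE /v scaleNr scalerDl scale1r scalerN opprD opprB addrAC.
      rewrite !enormZ normrN (ger0_norm l0) (ger0_norm (addr_ge0 ler01 l'0)) -/d.
      have ld : l * d <= l' * d by rewrite ler_pM2r.
      have hE : 12 * h = d by rewrite /h mulrC divfK.
      by rewrite hE ler0_norm mulrDl mul1r; lra.
    apply: (@face_lower_bound _ _ n1 D f g (f x0) x0 p q h t) => //.
    have -> : f p - f x0 = (1 + l) *: v.
      by rewrite pE /v scalerDl scale1r addrAC.
    have -> : f q - f x0 = l' *: - v by rewrite qE addrC addKr.
    rewrite !enormZ enormN (ger0_norm l'0) (ger0_norm (addr_ge0 ler01 l0)) -/d.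
    have ld : l' * d <= l * d by rewrite ler_pM2r// ltW.
    have hE : 12 * h = d by rewrite /h mulrC divfK.
    by rewrite hE ger0_norm mulrDl mul1r; lra.
  have := shell_lower_bound g'0 mg' (ltW K0) t00 t01 face.
  rewrite -[mB (cube 1)]fineK ?cube1_fin_num// -EFinM -lee_fin => H.
  apply: (le_trans H); rewrite [leRHS]EFinM lee_wpmul2l//.
    by rewrite lee_fin !mulr_ge0// ltW.
  apply: (le_trans (integral_shift_le x0 gg0 mg)).
  rewrite ge0_integralD//; apply: (le_trans (leeD ig0 ig1)).
  by rewrite -(fineK Qfin) -!EFinM -!EFinD lee_fin; lra.
have {}key : ln (t1 / t0) * fine (mB (cube 1)) <=
    K * (4 * n%:R) * (2 * (h ^- n * fine (\int[m]_y Q y)%E)).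
  apply/ler_addgt0Pr => e e0.
  have c0 : 0 < K * (8 * n%:R) by rewrite !mulr_gt0// ltr0n.
  have := key (e / (K * (8 * n%:R))) (divr_gt0 e0 c0); move/le_trans; apply.
  rewrite le_eqVlt; apply/orP; left; apply/eqP.
  move: (h ^- n) => H; field.
  by rewrite gt_eqF// ?ltr0n//= gt_eqF.
rewrite /distortion_constant -/K.
have hE : h ^- n = 12 ^+ n / d ^+ n by rewrite /h expr_div_n invf_div.
rewrite hE in key.
have dn0 : 0 < d ^+ n by rewrite exprn_gt0.
rewrite -ler_pdivlMl// -(ler_pM2r cube1); apply: (le_trans key).
rewrite le_eqVlt; apply/orP; left; apply/eqP.
have := lt0r_neq0 cube1; have := lt0r_neq0 dn0.
move: (d ^+ n) (12 ^+ n) (fine (mB (cube 1))) => dn c12 m0 dn1 m1.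
by field; rewrite dn1 m1.
Qed.

End distortion.

Section conclusion.
Context {R : realType} {n : nat}.
Hypothesis n1 : (1 < n)%N.
Local Notation m := (@lebesgue_measureRn R n).
Implicit Types (D : set 'rV[R]_n) (f : 'rV[R]_n -> 'rV[R]_n) (Q : 'rV[R]_n -> \bar R).

Let n0 : (0 < n)%N. Proof. exact: ltnW. Qed.

(** A segment that leaves [D] meets the frontier where it does so first. *)
Lemma eball_subset_domain D (x0 z : 'rV[R]_n) (r : R) : open D -> D x0 ->
  (r%:E < edistance x0 (frontier D))%E -> enorm (z - x0) <= r -> D z.
Proof.
move=> oD Dx0 rD zr; apply: contrapT => nDz.
pose w := z - x0; pose phi (t : R) := x0 + t *: w.
pose S := [set t : R | 0 <= t <= 1 /\ ~ D (phi t)].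
have S1 : S 1 by split; [rewrite ler01 lexx|rewrite /phi scale1r addrC subrK].
have lbS t : S t -> 0 <= t by move=> [/andP[]].
have infS : has_inf S by split; [exists 1|exists 0].
have cphi : continuous phi by exact: continuous_line.
have near_phi (t : R) (U : set 'rV[R]_n) : nbhs (phi t) U ->
    exists2 e : R, 0 < e & forall s, ball t e s -> U (phi s).
  move=> Us.
  have : nbhs t [set s : R | U (phi s)] by exact: (cphi t).
  by move=> /nbhs_ballP[e e0 he]; exists e.
pose T := inf S.
have T0 : 0 <= T by apply: lb_le_inf => //; exists 1.
have T1 : T <= 1 by apply: ge_inf => //; exists 0.
have nDT : ~ D (phi T).
  move=> DT; have [e e0 he] := near_phi T D (open_nbhs_nbhs (conj oD DT)).
  have [t [t01 nDt] te] := inf_adherent e0 infS.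
  have Tt : T <= t by apply: ge_inf => //; exists 0.
  by apply: nDt; apply: he; rewrite /ball/= distrC ger0_norm; rewrite /T in Tt *; lra.
have {}T0 : 0 < T.
  rewrite lt_neqAle T0 andbT; apply/eqP => TE.
  by apply: nDT; rewrite -TE /phi scale0r addr0.
have frT : frontier D (phi T).
  split; last by move=> /interior_subset.
  move=> U /near_phi[e e0 he].
  pose t := Num.max 0 (T - e / 2).
  have tT : t < T by rewrite /t gt_max T0 /=; lra.
  have t0 : 0 <= t by rewrite /t le_max lexx.
  exists (phi t); split.
    apply: contrapT => nDt; suff : T <= t by rewrite leNgt tT.
    by apply: ge_inf; [exists 0|split=> //; rewrite t0 (le_trans (ltW tT))].
  apply: he; rewrite /ball/= gtr0_norm ?subr_gt0//.
  have : T - e / 2 <= t by rewrite /t le_max lexx orbT.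
  lra.
have : (edistance x0 (frontier D) <= (enorm (x0 - phi T))%:E)%E.
  by apply: ereal_inf_lbound; exists (phi T).
move=> /(lt_le_trans rD); rewrite lte_fin ltNge => /negP; apply.
rewrite /phi opprD addNKr enormN enormZ ger0_norm ?(ltW T0)//.
by apply: le_trans zr; rewrite ler_piMl// enorm_ge0.
Qed.

Definition modulus_constant : R :=
  (4 * n)%:R * @distortion_constant R n `^ n%:R^-1.

Lemma modulus_constant_gt0 : 0 < modulus_constant.
Proof.
by rewrite /modulus_constant mulr_gt0 ?powR_gt0 ?distortion_constant_gt0// ltr0n muln_gt0 n0.
Qed.

(** The distortion estimate holds between points much closer to each other than
    to the boundary; a chain of [4 n] points reaches the others. *)
Lemma log_hoelder D Q f (x0 x : 'rV[R]_n) (r : R) :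
  open D -> (forall y, (0 <= Q y)%E) ->
  measurable_fun setT (Q : lebesgueRn R n -> \bar R) -> m.-integrable setT Q ->
  poletsky_family D Q f -> (forall z, enorm (z - x0) <= 2 * r -> D z) ->
  enorm (x - x0) < r ->
  enorm (f x - f x0) <=
    modulus_constant * fine ('N[m]_1[Q])%E `^ (n%:R^-1)
      / ln (1 + r / enorm (x - x0)) `^ (n%:R^-1).
Proof.
move=> oD Q0 mQ iQ Ff ballD xr.
have -> : ('N[m]_1[Q] = \int[m]_y Q y)%E.
  by rewrite Lnorm1; apply: eq_integral => y _; rewrite gee0_abs.
set q := fine _.
have q0 : 0 <= q by rewrite fine_ge0// integral_ge0.
have [->|xN] := eqVneq x x0.
  rewrite subrr enorm0 mulr_ge0 ?invr_ge0 ?powR_ge0// mulr_ge0 ?powR_ge0//.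
  exact/ltW/modulus_constant_gt0.
set e := enorm (x - x0) in xr *.
have e0 : 0 < e by rewrite enorm_gt0// subr_eq0.
have r0 : 0 < r by exact: lt_trans xr.
have nR : 0 < n%:R :> R by rewrite ltr0n.
set L := ln _.
have re : 1 < r / e by rewrite ltr_pdivlMr// mul1r.
have L0 : 0 < L by rewrite ln_gt0// ltrDl (lt_trans _ re).
(* The cubes have half-side r / n, so that they lie in balls of radius r, and
   the steps have length e / (4 n); twice this length is the inner radius t0,
   which makes the ratio of the radii 2 r / e >= 1 + r / e. *)
pose N := (4 * n)%N.
have N0 : 0 < N%:R :> R by rewrite ltr0n muln_gt0 n0.
pose X (k : nat) := x0 + (k%:R / N%:R) *: (x - x0).
pose b := (@distortion_constant R n * q / L) `^ n%:R^-1.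
have step k : (k < N)%N -> enorm (f (X k.+1) - f (X k)) <= b.
  move=> kN.
  have XS : enorm (X k.+1 - X k) = e / N%:R.
    rewrite /X opprD addrACA subrr add0r -scalerBl -mulrBl -natrB// subSnn mul1r.
    by rewrite enormZ normfV gtr0_norm// mulrC.
  have Xk : enorm (X k - x0) < r.
    rewrite /X addrC addKr enormZ ger0_norm ?divr_ge0//.
    apply: le_lt_trans xr; rewrite ler_piMl ?enorm_ge0//.
    by rewrite ler_pdivrMr// mul1r ler_nat ltnW.
  have cubeD z : `|z - X k| <= r / n%:R -> D z.
    move=> zX; apply: ballD; rewrite -(subrKA (X k)).
    apply: (le_trans (enormD _ _)); have := enorm_le_norm (z - X k).
    have : n%:R * `|z - X k| <= r by rewrite mulrC -ler_pdivlMr.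
    lra.
  have XS2 : `|X k.+1 - X k| < 2 * e / N%:R.
    apply: (le_lt_trans (norm_le_enorm _)); rewrite XS ltr_pM2r ?invr_gt0//; lra.
  have t01 : 2 * e / N%:R < r / n%:R.
    rewrite /N natrM ltr_pdivrMr ?mulr_gt0// (_ : r / n%:R * (4 * n%:R) = 4 * r); first lra.
    by field; rewrite gt_eqF.
  have := distortion_estimate n1 oD Q0 mQ iQ Ff cubeD XS2 t01.
  have -> : r / n%:R / (2 * e / N%:R) = 2 * (r / e).
    by rewrite /N natrM; field; rewrite !gt_eqF.
  rewrite -/q => dist.
  have LL : L <= ln (2 * (r / e)) by rewrite /L ler_ln ?posrE; lra.
  have {}dist : enorm (f (X k.+1) - f (X k)) ^+ n <= @distortion_constant R n * q / L.
    rewrite ler_pdivlMr//; apply: le_trans dist.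
    by rewrite ler_wpM2l// exprn_ge0// enorm_ge0.
  rewrite -[leLHS]powRr1 ?enorm_ge0// -(mulfV (lt0r_neq0 nR)) powRrM powR_mulrn ?enorm_ge0//.
  have dn0 : 0 <= enorm (f (X k.+1) - f (X k)) ^+ n by rewrite exprn_ge0// enorm_ge0.
  by rewrite ge0_ler_powR ?nnegrE ?invr_ge0// (le_trans dn0 dist).
have chain k : (k <= N)%N -> enorm (f (X k) - f x0) <= k%:R * b.
  elim: k => [_|k IHk kN]; first by rewrite /X !mul0r scale0r addr0 subrr enorm0.
  have := enormD (f (X k.+1) - f (X k)) (f (X k) - f x0); rewrite subrKA => /le_trans; apply.
  by rewrite -natr1 mulrDl mul1r addrC; exact: lerD (IHk (ltnW kN)) (step k kN).
have := chain N (leqnn _); rewrite /X divff ?gt_eqF// scale1r [x0 + _]addrC subrK => /le_trans; apply.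
have cd0 : 0 <= @distortion_constant R n by exact/ltW/(distortion_constant_gt0 n1).
rewrite /b /modulus_constant powRM ?invr_ge0 ?(ltW L0) ?(mulr_ge0 cd0 q0)//.
rewrite (powRM _ cd0 q0).
have LVp : (L^-1) `^ n%:R^-1 = (L `^ n%:R^-1)^-1.
  by rewrite -powR_inv1 ?(ltW L0)// powRAC powR_inv1// powR_ge0.
by rewrite LVp !mulrA.
Qed.

Lemma log_hoelder_equicontinuous D Q (x0 : 'rV[R]_n) (eps : R) :
  open D -> (forall y, (0 <= Q y)%E) ->
  measurable_fun setT (Q : lebesgueRn R n -> \bar R) -> m.-integrable setT Q ->
  D x0 -> 0 < eps ->
  exists delta : R, 0 < delta /\
    forall x, D x -> enorm (x - x0) < delta ->
    forall f, poletsky_family D Q f -> enorm (f x - f x0) < eps.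
Proof.
move=> oD Q0 mQ iQ Dx0 eps0.
have nR : 0 < n%:R :> R by rewrite ltr0n.
have /nbhs_ballP[s /= s0 sD] : nbhs x0 D by exact: open_nbhs_nbhs.
pose r := s / 4; have r0 : 0 < r by rewrite divr_gt0.
have ballD z : enorm (z - x0) <= 2 * r -> D z.
  move=> zr; apply: sD; rewrite -ball_normE /= distrC.
  by apply: (le_lt_trans (norm_le_enorm _)); apply: le_lt_trans zr _; rewrite /r; lra.
set A := modulus_constant * fine ('N[m]_1[Q])%E `^ (n%:R^-1).
have A0 : 0 <= A by rewrite mulr_ge0 ?powR_ge0// ltW// modulus_constant_gt0.
pose M := (A / eps + 1) ^+ n.
have Ae : 0 < A / eps + 1 by rewrite ltr_wpDl// divr_ge0// ltW.
have M0 : 0 < M by rewrite exprn_gt0.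
exists (r / expR M); split; first by rewrite divr_gt0// expR_gt0.
move=> x Dx xd f Ff.
have [->|xN] := eqVneq x x0; first by rewrite subrr enorm0.
have e0 : 0 < enorm (x - x0) by rewrite enorm_gt0// subr_eq0.
have xr : enorm (x - x0) < r.
  apply: lt_le_trans xd _; rewrite ler_pdivrMr ?expR_gt0// ler_peMr ?(ltW r0)//.
  by have := @expR_ge1Dx R M; lra.
apply: le_lt_trans (log_hoelder oD Q0 mQ iQ Ff ballD xr) _; rewrite -/A.
set L := ln _.
have ML : M < L.
  rewrite -[M]expRK ltr_ln ?posrE ?expR_gt0//; last by rewrite addr_gt0// divr_gt0.
  apply: (@lt_trans _ _ (r / enorm (x - x0))); last by rewrite ltrDr.
  by rewrite ltr_pdivlMr// mulrC -ltr_pdivlMr// expR_gt0.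
have L0 : 0 < L by exact: lt_trans ML.
have Lp : A / eps + 1 < L `^ n%:R^-1.
  have -> : A / eps + 1 = M `^ n%:R^-1.
    by rewrite /M -powR_mulrn ?(ltW Ae)// -powRrM mulfV ?lt0r_neq0// powRr1 ?(ltW Ae).
  by rewrite gt0_ltr_powR ?invr_gt0// ?nnegrE ?(ltW M0) ?(ltW L0).
rewrite ltr_pdivrMr ?powR_gt0// mulrC -ltr_pdivrMr//.
by apply: lt_trans Lp; rewrite ltrDl.
Qed.

End conclusion.

(** * The theorem *)

(* For x = x0 the right-hand side of the bound is 0, since [a / 0 = 0]:
   then [ln (1 + r0 / 0) = 0], and [0 `^ n^-1 = 0]. *)
Theorem mainTheorem1 (R : realType) (n : nat) (hn : (2 <= n)%N) :
  exists C : R, 0 < C /\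
  forall (D : set 'rV[R]_n) (Q : 'rV[R]_n -> \bar R),
    is_domain D ->
    (forall y, (0 <= Q y)%E) ->
    measurable_fun setT (Q : lebesgueRn R n -> \bar R) ->
    lebesgue_measureRn.-integrable setT Q ->
    (forall (x0 : 'rV[R]_n) (r0 : R), D x0 ->
       0 < 2 * r0 -> ((2 * r0)%:E < edistance x0 (frontier D))%E ->
       forall x, eball x0 r0 x -> forall f, poletsky_family D Q f ->
         enorm (f x - f x0) <=
           C * fine ('N[lebesgue_measureRn]_1[Q])%E `^ (n%:R^-1)
             / ln (1 + r0 / enorm (x - x0)) `^ (n%:R^-1)) /\
    (forall (x0 : 'rV[R]_n) (eps : R), D x0 -> 0 < eps ->
       exists delta : R, 0 < delta /\
       forall x, D x -> enorm (x - x0) < delta ->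
       forall f, poletsky_family D Q f -> enorm (f x - f x0) < eps).
Proof.
exists (@modulus_constant R n); split; first exact: modulus_constant_gt0.
move=> D Q [_ oD _] Q0 mQ iQ; split.
  move=> x0 r0 Dx0 _ rD x xr f Ff; apply: (log_hoelder hn oD) => // z zr.
  exact: (eball_subset_domain oD Dx0 rD zr).
by move=> x0 eps Dx0 eps0; exact: log_hoelder_equicontinuous.
Qed.
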